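(* Let $\mathcal{G}=(G,E)$ be a 4-connected planar graph in which some nodes are Byzantine, let $Z$ be the maximal number of edges of a polygon of $\mathcal{G}$, and let $D$ be the minimal distance (in hops) between two distinct Byzantine nodes. If $D > Z$, then the protocol described in the context achieves reliable broadcast: every correct node eventually delivers the source's information $m_0$.
   Context: Graph setting: $\mathcal{G}=(G,E)$ is a finite undirected graph which is planar, with a fixed planar (bidimensional) embedding in which edges do not cross, and 4-connected (removing any set of fewer than 4 nodes leaves the graph connected). A circular path is a sequence of nodes $(u_1,\dots,u_n)$ with $u_i,u_{i+1}$ adjacent and $u_n,u_1$ adjacent. A polygon is a circular path that does not surround any node in the embedding. $Z\ge 3$ is the maximal number of edges per polygon. Each node is either correct or Byzantine; Byzantine nodes behave arbitrarily, and correct nodes do not know which nodes are Byzantine. Network model: nodes communicate only with neighbors by messages; the network is asynchronous (every message sent is eventually received, after arbitrary delay; every process is activated infinitely often in an infinite execution, in arbitrary order); channels are authenticated (each node has a unique identifier and, upon receiving a message from a neighbor $p$, knows that $p$ sent it). A correct node called the source wants to broadcast an information $m_0$. A correct node multicasts a message when it sends it to all its neighbors, and delivers $m$ when it permanently considers $m$ to be the information broadcast by the source. Reliable broadcast is achieved if all correct nodes eventually deliver $m_0$. Protocol (parameter $Z$; messages are pairs $(m,S)$ with $S$ a set of node identifiers): (1) The source multicasts $m_0$. (2) Each correct neighbor of the source waits until it receives an information $m$ from the source, then delivers $m$ and multicasts $(m,\emptyset)$. (3) Every other correct node keeps, for each neighbor $q$, a variable $Rec(q)$ and behaves as follows: when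 it receives $(m,S)$ from a neighbor $q$ with $q\notin S$ and $|S|\le Z-3$, it sets $Rec(q):=(m,S)$ and multicasts $(m,S\cup\{q\})$; when there exist $m,p,q,S$ with $q\neq p$, $q\notin S$, $Rec(q)=(m,\emptyset)$ and $Rec(p)=(m,S)$, it delivers $m$, multicasts $(m,\emptyset)$ and stops.
   Formalization: Channels are additionally assumed first-in first-out (messages from a node to a neighbor are received in sending order); without this a stale message can overwrite a final (m,∅) in Rec and a correct node may never deliver. *)

(* Defs.v *)
(* MathComp + MathComp-Analysis *)
From HB Require Import structures.
From mathcomp Require Import all_boot all_order all_algebra.
From mathcomp Require Import all_classical all_reals all_analysis.
Import Order.TTheory GRing.Theory Num.Theory.
Import numFieldNormedType.Exports.

Set Implicit Arguments.
Unset Strict Implicit.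
Unset Printing Implicit Defensive.

Local Open Scope classical_set_scope.
Local Open Scope ring_scope.

(** * Graphs

    A finite simple undirected graph is a symmetric irreflexive [e : rel T] on
    a [finType]; both properties are hypotheses of the theorem. *)

Definition connected_without (T : finType) (e : rel T) (S : {set T}) : Prop :=
  forall x y : T, x \notin S -> y \notin S ->
    connect [rel u v | [&& e u v, u \notin S & v \notin S]] x y.

Definition four_connected (T : finType) (e : rel T) : Prop :=
  forall S : {set T}, (#|S| < 4)%N -> connected_without e S.

(* The least number of edges of a walk from [x] to [y]; in a connected graph
   this is always smaller than #|T|. *)
Definition dist (T : finType) (e : rel T) (x y : T) : nat :=
  find (fun n => [exists p : n.-tuple T, path e x p && (last x p == y)])
       (iota 0 #|T|).

(** * Planar embeddings *)

(* Edges are drawn as Jordan arcs: [edge_arc x y], restricted to [0, 1], is a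
   continuous injective curve from [node_pt x] to [node_pt y].  Values of [edge_arc x y]
   outside [0, 1], or for non-adjacent [x] and [y], are irrelevant. *)
Record plane_embedding (R : realType) (T : finType) (e : rel T) := PlaneEmbedding {
  node_pt : T -> R * R;
  edge_arc : T -> T -> R -> R * R;
  node_pt_inj : injective node_pt;
  edge_arc0 : forall x y : T, e x y -> edge_arc x y 0 = node_pt x;
  edge_arc1 : forall x y : T, e x y -> edge_arc x y 1 = node_pt y;
  edge_arc_sym : forall (x y : T) (t : R), e x y -> t \in `[0, 1] -> edge_arc y x t = edge_arc x y (1 - t);
  edge_arc_continuous : forall x y : T, e x y -> {within `[0, 1], continuous (edge_arc x y)};
  edge_arc_inj : forall x y : T, e x y -> {in `[0, 1] &, injective (edge_arc x y)};
  edge_arc_avoids_nodes : forall (x y z : T) (t : R), e x y -> t \in `]0, 1[ -> edge_arc x y t <> node_pt z;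
  edge_arc_no_crossing : forall (x y x' y' : T) (t t' : R), e x y -> e x' y' ->
    [set x; y]%SET != [set x'; y']%SET ->
    t \in `]0, 1[ -> t' \in `]0, 1[ -> edge_arc x y t <> edge_arc x' y' t'
}.

Definition edge_curve (R : realType) (T : finType) (e : rel T)
    (emb : plane_embedding R e) (x y : T) : set (R * R) :=
  edge_arc emb x y @` `[0, 1].

(* The nodes of a circular path are pairwise distinct and there are at least
   three of them: if nodes could be repeated, going back and forth along an
   edge would give circular paths of every even length that surround nothing.
   A circular path has [size c] edges. *)
Definition circular_path (T : finType) (e : rel T) (c : seq T) : Prop :=
  ucycle e c /\ (2 < size c)%N.

Definition path_curve (R : realType) (T : finType) (e : rel T)
    (emb : plane_embedding R e) (c : seq T) : set (R * R) :=
  [set p | exists2 x, x \in c & edge_curve emb x (next c x) p].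

(* The point [p] lies in a bounded component of the complement of the closed
   curve drawn by [c]. *)
Definition surrounds (R : realType) (T : finType) (e : rel T)
    (emb : plane_embedding R e) (c : seq T) (p : R * R) : Prop :=
  ~ path_curve emb c p /\
  bounded_set (connected_component (~` path_curve emb c) p).

Definition polygon (R : realType) (T : finType) (e : rel T)
    (emb : plane_embedding R e) (c : seq T) : Prop :=
  circular_path e c /\ forall z : T, ~ surrounds emb c (node_pt emb z).

(* A polygon may have edges drawn inside it, like the contour of two adjacent
   cells of a grid; for instance, every Hamiltonian cycle is a polygon.  An
   elementary polygon has none: it is the boundary of a single bounded face. *)
Definition elementary_polygon (R : realType) (T : finType) (e : rel T)
    (emb : plane_embedding R e) (c : seq T) : Prop :=
  polygon emb c /\
  forall (x y : T) (p : R * R), e x y -> edge_curve emb x y p ->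
    ~ surrounds emb c p.

Definition max_edges (T : finType) (P : seq T -> Prop) (Z : nat) : Prop :=
  (exists2 c, P c & size c = Z) /\ (forall c, P c -> (size c <= Z)%N).

(** * The protocol *)

(* [Info m] is the raw information multicast by the source, and [Relay m S] is
   the pair (m, S). *)
Inductive message (T : finType) (M : Type) : Type :=
| Info of M
| Relay of M & {set T}.
Arguments Info {T M}.
Arguments Relay {T M}.

(* [delivered] is written at most once by a correct node, which ignores
   everything it receives afterwards. *)
Record local_state (T : finType) (M : Type) := LocalState {
  delivered : option M;
  Rec : T -> option (M * {set T})
}.

Definition can_deliver (T : finType) (M : Type)
    (rec : T -> option (M * {set T})) (m : M) : Prop :=
  exists (p q : T) (S : {set T}),
    [/\ q != p, q \notin S, rec q = Some (m, finset.set0) & rec p = Some (m, S)].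

(* Reactions of correct nodes.  The input is [None] if the node is activated
   without receiving anything and [Some (q, x)] if it receives [x] from [q];
   [out] is the list of messages multicast, in this order. *)

(* The source sends [m0] the first time it is activated, and is then considered
   to have delivered it. *)
Definition source_reaction (T : finType) (M : Type) (m0 : M)
    (st st' : local_state T M) (out : seq (message T M)) : Prop :=
  if delivered st is None
  then st' = LocalState (Some m0) (Rec st) /\ out = [:: Info m0]
  else st' = st /\ out = [::].

Definition neighbor_reaction (T : finType) (M : Type) (src : T)
    (input : option (T * message T M))
    (st st' : local_state T M) (out : seq (message T M)) : Prop :=
  match delivered st, input with
  | None, Some (q, Info m) =>
      if q == src
      then st' = LocalState (Some m) (Rec st) /\ out = [:: Relay m finset.set0]
      else st' = st /\ out = [::]
  | _, _ => st' = st /\ out = [::]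
  end.

(* The delivery condition is tested right after each update of [Rec], before
   any other message is received. *)
Definition other_reaction (T : finType) (M : Type) (Z : nat)
    (input : option (T * message T M))
    (st st' : local_state T M) (out : seq (message T M)) : Prop :=
  match delivered st, input with
  | None, Some (q, Relay m A) =>
      if (q \notin A) && (#|A| <= Z - 3)%N then
        let rec' := [eta Rec st with q |-> Some (m, A)] in
        let fwd := Relay m (q |: A)%SET in
        (exists m', [/\ can_deliver rec' m',
                        st' = LocalState (Some m') rec' &
                        out = [:: fwd; Relay m' finset.set0]])
        \/
        [/\ forall m', ~ can_deliver rec' m',
            st' = LocalState None rec' & out = [:: fwd]]
      else st' = st /\ out = [::]
  | _, _ => st' = st /\ out = [::]
  end.

Definition reaction (T : finType) (M : Type) (e : rel T) (src : T) (m0 : M)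
    (Z : nat) (v : T) (input : option (T * message T M))
    (st st' : local_state T M) (out : seq (message T M)) : Prop :=
  if v == src then source_reaction m0 st st' out
  else if e src v then neighbor_reaction src input st st' out
  else other_reaction Z input st st' out.

(** * Executions *)

(* [channel c p q] is the queue of the messages sent by [p] to [q] and not yet
   received.  Channels are first-in first-out, with unbounded delays: [Rec q]
   keeps only the last message received from [q], so if channels could reorder
   messages, a stale message could overwrite a final pair (m, {}) forever. *)
Record config (T : finType) (M : Type) := Config {
  state : T -> local_state T M;
  channel : T -> T -> seq (message T M)
}.

Definition initial (T : finType) (M : Type) (c : config T M) : Prop :=
  (forall v, state c v = LocalState None (fun=> None)) /\
  (forall p q, channel c p q = [::]).

(* The activated node, and the neighbor from which it receives a message (the
   oldest one in the channel), if any. *)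
Definition activation (T : finType) : Type := (T * option T)%type.

Definition receive (T : finType) (M : Type) (a : activation T)
    (ch ch' : T -> T -> seq (message T M))
    (input : option (T * message T M)) : Prop :=
  match a with
  | (_, None) => ch' = ch /\ input = None
  | (v, Some q) => exists (x : message T M) (r : seq (message T M)),
      [/\ ch q v = x :: r,
          ch' = (fun p w => if (p == q) && (w == v) then r else ch p w) &
          input = Some (q, x)]
  end.

(* A Byzantine node has an unconstrained state and may send any finite list of
   messages to each of its neighbors, but only on its own channels. *)
Definition step (T : finType) (M : Type) (e : rel T) (B : {set T}) (src : T)
    (m0 : M) (Z : nat) (c : config T M) (a : activation T) (c' : config T M)
    : Prop :=
  let v := a.1 in
  exists (ch : T -> T -> seq (message T M)) (input : option (T * message T M))
         (out : T -> seq (message T M)),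
    [/\ receive a (channel c) ch input,
        forall w, w != v -> state c' w = state c w,
        forall p q, channel c' p q =
          ch p q ++ (if (p == v) && e v q then out q else [::]) &
        v \notin B -> exists2 l, reaction e src m0 Z v input (state c v) (state c' v) l
                              & forall q, out q = l].

(* Since channels are queues, the last clause says exactly that every message
   sent is eventually received. *)
Definition execution (T : finType) (M : Type) (e : rel T) (B : {set T})
    (src : T) (m0 : M) (Z : nat) (cfg : nat -> config T M)
    (act : nat -> activation T) : Prop :=
  [/\ initial (cfg 0%N),
      forall n, step e B src m0 Z (cfg n) (act n) (cfg n.+1),
      forall v n, exists2 k, (n <= k)%N & (act k).1 = v &
      forall p q n, channel (cfg n) p q <> [::] ->
        exists2 k, (n <= k)%N & act k = (q, Some p)].

Definition eventually_delivers (T : finType) (M : Type)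
    (cfg : nat -> config T M) (v : T) (m : M) : Prop :=
  exists n, forall k, (n <= k)%N -> delivered (state (cfg k) v) = Some m.

(* Main.v *)
(* A correct node is never fooled: a false message that reaches it through relays carries
   the identifier of the Byzantine node that forged it, which is then too close to a second
   Byzantine node. As for progress, if q, w_1, ..., w_k, u is a path with k <= Z - 2 whose
   end nodes deliver, then some w_i delivers: relayed copies of the message travel from q to
   the right and from u to the left, and at one of the two ends the relayed copy arrives
   after the direct one.

   Suppose some correct node never delivers. Let C be its component among the nodes that do
   not deliver, and D the component of the source in the rest of the graph. An elementary
   polygon that meets C and has two nodes in D would contain such a path, so it contains a
   Byzantine node of C; by the distance hypothesis this is the same node b for all of them.
   Hence for a node n of D the set K(n) of edges between n and C - b meets every elementary
   polygon that avoids b in an even number of edges. The elementary polygons that avoid b,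
   together with at most one further cycle Phi (the boundary of the face that appears when b
   is deleted), generate the cycle space of G - b over the field with two elements. So K(n)
   and K(n'), or their sum, would be a cut of G - b, which contradicts 4-connectedness.

   Generation holds because a cycle that surrounds some edge is the sum of two cycles that
   surround fewer edges. The only fact used about the plane is that an arc does not separate
   a bounded region from the rest: every edge of a cycle that surrounds something is
   adherent both to the region it surrounds and to its exterior. *)
Require Import Defs.
From HB Require Import structures.
From mathcomp Require Import all_boot all_order all_algebra.
From mathcomp Require Import all_classical all_reals all_analysis.
From mathcomp Require Import zify ring lra.
Import Order.TTheory GRing.Theory Num.Theory.
Import numFieldNormedType.Exports.

Set Implicit Arguments.
Unset Strict Implicit.
Unset Printing Implicit Defensive.

Local Open Scope classical_set_scope.
Local Open Scope ring_scope.

(** * Arcs in the plane *)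

Lemma telescope_addb (f : nat -> bool) (n : nat) :
  \big[addb/false]_(j < n) (f j (+) f j.+1) = f 0%N (+) f n.
Proof.
elim: n => [|n IH]; first by rewrite big_ord0 addbb.
by rewrite big_ord_recr /= IH; case: (f 0%N) (f n) (f n.+1) => [] [] [].
Qed.

(** Discrete Stokes formula modulo 2: [h i j] and [v i j] weigh the horizontal and the vertical edge
    that start at the grid point (i, j). An interior edge belongs to two cells and cancels. *)
Lemma grid_parity (h v : nat -> nat -> bool) (n : nat) :
  (forall i j, (i < n)%N -> (j < n)%N ->
     (h i j (+) h i j.+1) (+) (v i j (+) v i.+1 j) = false) ->
  \big[addb/false]_(i < n) (h i 0%N (+) h i n) (+)
  \big[addb/false]_(j < n) (v 0%N j (+) v n j) = false.
Proof.
move=> cell.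
rewrite -(eq_bigr _ (fun (i : 'I_n) _ => telescope_addb (h i) n)).
rewrite -(eq_bigr _ (fun (j : 'I_n) _ => telescope_addb (v^~ j) n)).
rewrite [X in _ (+) X]exchange_big -big_split big1 // => i _.
by rewrite -big_split big1 // => j _; exact: cell.
Qed.

Section NoRetraction.
Context (R : realType).
Implicit Types (F : R * R -> R * R) (p z : R * R).

Lemma continuous_fst_comp F : continuous F -> continuous (fun z => (F z).1).
Proof. by move=> cF z; exact: (cvg_comp _ _ (cF z) cvg_fst). Qed.

Lemma continuous_snd_comp F : continuous F -> continuous (fun z => (F z).2).
Proof. by move=> cF z; exact: (cvg_comp _ _ (cF z) cvg_snd). Qed.

Let X F z := 0 < (F z).1.
Let Y F z := 0 <= (F z).2.

(** If the second coordinate of [F p] is nonzero, its sign is locally constant; otherwise the first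
    one is nonzero and keeps its sign. *)
Lemma near_sign F p : continuous F -> F p <> 0 ->
  (\forall z \near p, Y F z = Y F p) \/ (\forall z \near p, X F z = X F p).
Proof.
move=> cF Fp0.
have c1 := @continuous_fst_comp F cF p; have c2 := @continuous_snd_comp F cF p.
have [y0|y0|y0] := ltgtP (F p).2 0.
- left; apply: (@filterS _ (nbhs p) _ _ _ _ (c2 _ (lt_nbhsl y0))) => z /= zy.
  by rewrite /Y !leNgt y0 zy.
- left; apply: (@filterS _ (nbhs p) _ _ _ _ (c2 _ (lt_nbhsr y0))) => z /= zy.
  by rewrite /Y !ltW.
have [x0|x0|x0] := ltgtP (F p).1 0.
- right; apply: (@filterS _ (nbhs p) _ _ _ _ (c1 _ (lt_nbhsl x0))) => z /= zx.
  by rewrite /X !ltNge !ltW.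
- right; apply: (@filterS _ (nbhs p) _ _ _ _ (c1 _ (lt_nbhsr x0))) => z /= zx.
  by rewrite /X zx x0.
by case: Fp0; move: x0 y0; case: (F p) => a b /= -> ->.
Qed.

(** Crossing of the positive horizontal half-axis by the image of an edge. The abscissa is tested at
    [z] only, which is enough on small cells, where [X] is constant whenever [Y] varies. *)
Let kappa F z w := (Y F z (+) Y F w) && X F z.

(** If [Y] is constant near [p], no edge crosses; if [X] is, the changes of [Y] cancel around the
    cell with corners [a], [b], [d], [c]. *)
Lemma cell_even F p : continuous F -> F p <> 0 ->
  exists2 r : R, 0 < r & forall a b c d, ball p r a -> ball p r b ->
    ball p r c -> ball p r d ->
    (kappa F a b (+) kappa F c d) (+) (kappa F a c (+) kappa F b d) = false.
Proof.
move=> cF Fp0; case: (near_sign cF Fp0) => /nbhs_ballP[r /= r0 near];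
  exists r => // a b c d /near/= Na /near/= Nb /near/= Nc /near/= Nd;
  rewrite /kappa.
  by rewrite Na Nb Nc Nd addbb.
rewrite Na Nb Nc; case: (X F p); rewrite ?andbT ?andbF //.
by case: (Y F a) (Y F b) (Y F c) (Y F d) => [] [] [] [].
Qed.

(* The parity of the number of crossings of the positive horizontal half-axis
   is computed along the boundary of a square, and cell by cell. *)
Lemma no_retraction F (M : R) : 0 < M -> continuous F ->
  (forall z, M <= `|z| -> F z = z) -> exists z, F z = 0.
Proof.
move=> M0 cF Fid; apply: contrapT => noz.
have Fn0 z : F z <> 0 by move=> Fz; apply: noz; exists z.
pose g (n i : nat) : R := - M + 2 * M * i%:R / n.+1%:R.
have gM n : g n n.+1 = M by rewrite /g mulfK ?pnatr_eq0 //; ring.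
have g0 n : g n 0%N = - M by rewrite /g; ring.
have gS n i : g n i.+1 = g n i + 2 * M / n.+1%:R.
  by rewrite /g -[i.+1%:R]natr1 mulrDr mulr1 mulrDl addrA.
have g_ge n i : - M <= g n i by rewrite /g lerDl !mulr_ge0 ?invr_ge0 // ltW.
have g_le n i : (i <= n.+1)%N -> g n i <= M.
  move=> le; rewrite -[leRHS](gM n) /g lerD2l ler_pM2r ?invr_gt0 //.
  by rewrite ler_pM2l ?ler_nat // mulr_gt0.
(* Otherwise the boundary would be even by [grid_parity]; but [F] is the identity there, and only
   the right side of the square crosses the half-axis, exactly once. *)
have odd_cell n : exists ij : nat * nat,
    [/\ (ij.1 < n.+1)%N, (ij.2 < n.+1)%N &
     let i := ij.1 in let j := ij.2 in
     (kappa F (g n i, g n j) (g n i.+1, g n j) (+)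
      kappa F (g n i, g n j.+1) (g n i.+1, g n j.+1)) (+)
     (kappa F (g n i, g n j) (g n i, g n j.+1) (+)
      kappa F (g n i.+1, g n j) (g n i.+1, g n j.+1)) = true].
  apply: contrapT => none.
  have bd (z : R * R) : `|z.1| = M \/ `|z.2| = M -> F z = z.
    by move=> zM; apply: Fid; rewrite prod_normE le_max; case: zM => ->; rewrite lexx ?orbT.
  have nM : `|- M| = M by rewrite normrN gtr0_norm.
  have pM : `|M| = M by rewrite gtr0_norm.
  have := @grid_parity (fun i j => kappa F (g n i, g n j) (g n i.+1, g n j))
    (fun i j => kappa F (g n i, g n j) (g n i, g n j.+1)) n.+1 _.
  rewrite big1 => [|i _]; last first.
    rewrite /kappa /Y !bd ?gM ?g0 /=; try by right.
    by rewrite !(ltW M0) !leNgt oppr_lt0 M0.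
  rewrite (eq_bigr (fun j : 'I_n.+1 => (0 <= g n j) (+) (0 <= g n j.+1))); last first.
    move=> j _; rewrite /kappa /X /Y !bd ?gM ?g0 /=; try by left.
    by rewrite M0 oppr_gt0 ltNge (ltW M0) andbF andbT.
  rewrite (telescope_addb (fun j => 0 <= g n j)) gM g0 (ltW M0) leNgt oppr_lt0 M0.
  have cells i j : (i < n.+1)%N -> (j < n.+1)%N ->
     (kappa F (g n i, g n j) (g n i.+1, g n j) (+)
      kappa F (g n i, g n j.+1) (g n i.+1, g n j.+1)) (+)
     (kappa F (g n i, g n j) (g n i, g n j.+1) (+)
      kappa F (g n i.+1, g n j) (g n i.+1, g n j.+1)) = false.
    by move=> ilt jlt; apply/negbTE/negP => odd; apply: none; exists (i, j).
  by move=> /(_ cells).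
pose ij n := xget (0%N, 0%N) [set ij | [/\ (ij.1 < n.+1)%N, (ij.2 < n.+1)%N &
     let i := ij.1 in let j := ij.2 in
     (kappa F (g n i, g n j) (g n i.+1, g n j) (+)
      kappa F (g n i, g n j.+1) (g n i.+1, g n j.+1)) (+)
     (kappa F (g n i, g n j) (g n i, g n j.+1) (+)
      kappa F (g n i.+1, g n j) (g n i.+1, g n j.+1)) = true]].
have ijP n : _ := xgetPex (0%N, 0%N) (odd_cell n).
pose z n := (g n (ij n).1, g n (ij n).2).
have zbox n : (`[- M, M] `*` `[- M, M])%classic (z n).
  by have [/ltnW/g_le lei /ltnW/g_le lej _] := ijP n; split; rewrite /= in_itv /= g_ge.
(* Corners of odd cells of finer and finer grids accumulate at some [p]; a fine odd cell close to
   [p] then contradicts [cell_even]. *)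
have [p [_ clp]] : ((`[- M, M] `*` `[- M, M])%classic `&` cluster (z @ \oo)) !=set0.
  apply: (compact_setX (@segment_compact R (- M) M) (@segment_compact R (- M) M)).
  by exists 0%N => // n _; exact: zbox.
have [r r0 even] := cell_even cF (Fn0 p).
have r20 : 0 < r / 2 by rewrite divr_gt0.
have small : \forall n \near \oo, 2 * M / n.+1%:R < r / 2.
  have e0 : 0 < r / 2 / (2 * M) by rewrite divr_gt0 // mulr_gt0.
  have := near_infty_natSinv_lt (PosNum e0); apply: filterS => n /= lt.
  by rewrite mulrC -ltr_pdivlMr // mulr_gt0.
have [w [[n sn <-] pz]] := clp [set w | exists2 n, 2 * M / n.+1%:R < r / 2 & z n = w] _ 
   (filterS (fun n sn => ex_intro2 _ _ n sn erefl) small) (nbhsx_ballx p (r/2) r20).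
have near_p i j : (i = (ij n).1 \/ i = (ij n).1.+1) ->
    (j = (ij n).2 \/ j = (ij n).2.+1) -> ball p r (g n i, g n j).
  case: pz => p1 p2 Hi Hj; have rr : r = r / 2 + r / 2 by lra.
  have step i' : ball (g n i') (r / 2) (g n i'.+1).
    by rewrite /ball /= gS opprD addrA subrr add0r normrN gtr0_norm // divr_gt0 // mulr_gt0.
  have stay i' : ball (g n i') (r / 2) (g n i') by exact: ballxx.
  rewrite rr; split=> /=.
    by apply: (ball_triangle p1); case: Hi => [->|->]; [exact: stay|exact: step].
  by apply: (ball_triangle p2); case: Hj => [->|->]; [exact: stay|exact: step].
have [_ _] := ijP n.
by rewrite /= even //; apply: near_p; auto.
Unshelve. all: by end_near. Qed.
End NoRetraction.

(** * Components of open sets of the plane *)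

Section PlaneComponents.
Context (R : realType).
Implicit Types (O U : set (R * R)) (p q x y z : R * R).

Lemma segment_component O x y :
  (forall t : R, 0 <= t <= 1 ->
     O (x.1 + t * (y.1 - x.1), x.2 + t * (y.2 - x.2))) ->
  connected_component O x y.
Proof.
move=> segO; pose f (t : R) := (x.1 + t * (y.1 - x.1), x.2 + t * (y.2 - x.2)).
have cf : continuous f.
  have affine (a d : R) : continuous (fun t : R => a + t * d).
    move=> t; apply: (@continuousD R R^o R (cst a) (fun t => t * d)).
      exact: cvg_cst.
    by apply: (@continuousM R R id (cst d)); [exact: cvg_id|exact: cvg_cst].
  move=> t; exact: (cvg_pair (affine _ _ t) (affine _ _ t)).
exists (f @` `[0, 1]); last first.
  by exists 1; rewrite /= ?in_itv /= ?ler01 ?lexx // /f !mul1r !subrKC; case: (y).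
split.
- by exists 0; rewrite /= ?in_itv /= ?ler01 ?lexx // /f !mul0r !addr0; case: (x).
- by move=> _ [t + <-]; rewrite /= in_itv /=; exact: segO.
- apply: connected_continuous_connected; first exact: segment_connected.
  exact: continuous_subspaceT.
Qed.

Lemma ball_component O x y (r : R) : ball x r `<=` O -> ball x r y ->
  connected_component O x y.
Proof.
move=> brO [y1 y2]; apply: segment_component => t /andP[t0 t1]; apply: brO.
have near (a b : R) : ball a r b -> ball a r (a + t * (b - a)).
  rewrite /ball /= opprD addNKr normrN normrM distrC (ger0_norm t0).
  by apply: le_lt_trans; rewrite ler_piMl.
by split; exact: near.
Qed.

(** Balls are convex, so a small ball around a point of [O] lies inside a component as soon as it
    meets it. Hence components are open, and closed relative to [O]. *)
Lemma component_ball O p x : open O -> O x -> exists2 r : R, 0 < r &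
  ball x r `<=` O /\ (connected_component O p `&` ball x r !=set0 ->
  ball x r `<=` connected_component O p).
Proof.
move=> oO Ox; have /nbhs_ballP[r /= r0 rO] : nbhs x O by exact: open_nbhs_nbhs.
exists r => //; split=> // -[y [py xy]] z xz.
apply: (connected_component_trans py).
apply: (@connected_component_trans _ _ x); last exact: (ball_component rO).
by apply: connected_component_sym; exact: (ball_component rO).
Qed.

Lemma component_open O p : open O -> open (connected_component O p).
Proof.
move=> oO; rewrite openE => x px; have Ox := connected_component_sub px.
have [r r0 [_ rp]] := component_ball p oO Ox.
apply/nbhs_ballP; exists r => //; apply: rp; exists x; split=> //.
exact: ballxx.
Qed.

Lemma component_closure O p : open O ->
  closure (connected_component O p) `&` O `<=` connected_component O p.
Proof.
move=> oO x [clx Ox]; have [r r0 [_]] := component_ball p oO Ox.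
apply; last exact: ballxx.
by have [y [py xy]] := clx _ (nbhsx_ballx x r r0); exists y.
Qed.

(** The complement of a square is the union of four half-planes. Each point is joined to the upper
    right corner inside one of them, or inside two of them by way of a neighbouring corner. *)
Lemma outside_component O (N : R) x y : 0 <= N ->
  (forall z, N < `|z| -> O z) -> N < `|x| -> N < `|y| ->
  connected_component O x y.
Proof.
move=> N0 out.
suff corner z : N < `|z| -> connected_component O z (N + 1, N + 1).
  move=> /corner xc /corner yc; apply: (connected_component_trans xc).
  exact: connected_component_sym.
have half u v : (forall t, 0 <= t <= 1 ->
    (N < u.1 + t * (v.1 - u.1)) \/ (u.1 + t * (v.1 - u.1) < - N) \/
    (N < u.2 + t * (v.2 - u.2)) \/ (u.2 + t * (v.2 - u.2) < - N)) ->
    connected_component O u v.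
  move=> uv; apply: segment_component => t /uv le; apply: out.
  rewrite prod_normE lt_max !ltr_normr /=.
  case: le => [|[|[]]] H; apply/orP; [left|left|right|right];
    apply/orP; [left|right|left|right]; by rewrite // ltrNr.
have gtC (k a b t : R) : k < a -> k < b -> 0 <= t <= 1 -> k < a + t * (b - a).
  move=> ka kb /andP[t0 t1]; have [ab|/ltW ba] := leP a b; first by nra.
  by apply: (lt_le_trans kb); nra.
have ltC (k a b t : R) : a < k -> b < k -> 0 <= t <= 1 -> a + t * (b - a) < k.
  by move=> ka kb t01; have := @gtC (- k) (- a) (- b) t; lra.
rewrite prod_normE lt_max !ltr_normr => Nz.
case/orP: Nz => /orP[] Nz.
- by apply: half => t t01 /=; left; apply: gtC => //; lra.
- apply: (@connected_component_trans _ _ (- N - 1, N + 1)).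
    by apply: half => t t01 /=; right; left; apply: ltC => //; lra.
  by apply: half => t t01 /=; right; right; left; apply: gtC => //; lra.
- by apply: half => t t01 /=; right; right; left; apply: gtC => //; lra.
- apply: (@connected_component_trans _ _ (N + 1, - N - 1)).
    by apply: half => t t01 /=; right; right; right; apply: ltC => //; lra.
  by apply: half => t t01 /=; left; apply: gtC => //; lra.
Qed.

End PlaneComponents.

(** * Arcs: retractions, complements, concatenation *)

Definition is_arc (R : realType) (A : set (R * R)) (a b : R * R) : Prop :=
  exists g : R -> R * R, [/\ {within `[0, 1], continuous g},
    {in `[0, 1] &, injective g}, g 0 = a, g 1 = b & A = g @` `[0, 1]].

Section Arcs.
Context (R : realType).
Implicit Types (A : set (R * R)) (p q x y z : R * R).

Let hausdorff2 : hausdorff_space (R * R)%type.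
Proof. exact: (@norm_hausdorff R (R * R)%type). Qed.

Lemma arc_compact A a b : is_arc A a b -> compact A.
Proof.
by case=> g [cg _ _ _ ->]; apply: continuous_compact => //; exact: segment_compact.
Qed.

Lemma arc_closed A a b : is_arc A a b -> closed A.
Proof. by move=> /arc_compact; exact: compact_closed. Qed.

Lemma within01P (g : R -> R * R) : {within `[0, 1], continuous g} ->
  forall f : R * R -> R, continuous f -> (forall z, 0 <= f z <= 1) ->
  continuous (g \o f).
Proof.
move=> cg f cf f01 z B gB.
have itv w : `[0, 1]%classic (f w) by rewrite /= in_itv /=.
have H := cf z _ ((subspace_continuousP _ _).1 cg (f z) (itv z) B gB).
by apply: (@filterS _ (nbhs z) _ _ _ _ H) => w /= /(_ (itv w)).
Qed.

Lemma continuous_clamp01 (g : R * R -> R) : continuous g ->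
  continuous (fun z => Num.max 0 (Num.min 1 (g z))).
Proof.
move=> cg z; have cst_cont (k : R) : {for z, continuous (cst k : R * R -> R^o)}.
  exact: cvg_cst.
exact: (continuous_max (cst_cont 0) (continuous_min (cst_cont 1) (cg z))).
Qed.

(** The inverse of the parametrization is continuous by compactness. It extends to the plane by
    Tietze's theorem, and after clamping to the unit interval it can be composed with [g]. *)
Lemma arc_retract A a b : is_arc A a b -> exists r : R * R -> R * R,
  [/\ continuous r, forall z, A (r z) & forall z, A z -> r z = z].
Proof.
move=> arcA; have clA := arc_closed arcA.
case: arcA => g [cg ig _ _ AE].
have Ag t : 0 <= t <= 1 -> A (g t) by move=> t01; rewrite AE; exists t; rewrite //= in_itv.
pose h z : R := xget 0 [set t | 0 <= t <= 1 /\ g t = z].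
have hP z : A z -> 0 <= h z <= 1 /\ g (h z) = z.
  rewrite AE => -[t]; rewrite /= in_itv /= => t01 gt.
  by apply: (@xgetPex _ 0 [set t | 0 <= t <= 1 /\ g t = z]); exists t.
have hg t : 0 <= t <= 1 -> h (g t) = t.
  move=> t01; have [h01 gh] := hP _ (Ag _ t01).
  by apply: ig gh; rewrite in_itv.
(* The preimage of a closed set [C] under [h] is the image under [g] of a compact set, hence
   closed. *)
have ch : {within A, continuous (h : R * R -> R^o)}.
  apply/continuous_closedP => C cC; apply/closed_subspaceP.
  exists (g @` (`[0, 1] `&` C)).
    apply: compact_closed => //; apply: continuous_compact.
      by apply: continuous_subspaceW cg => t [].
    by apply: compact_closedI => //; exact: segment_compact.
  apply/seteqP; split=> z.
    by move=> [[t [+ Ct] <-] Az]; rewrite /= in_itv /= => t01; have Ch : C (h (g t)) by rewrite hg.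
  move=> [Ch Az]; have [h01 gh] := hP _ Az; split=> //.
  by exists (h z) => //; split; rewrite //= in_itv.
have [|k [hk ck _]] := @continuous_bounded_extension (R * R)%type R pseudometric_normal A clA h 1 ltr01 ch.
  by move=> z /hP[/andP[h0 h1] _]; rewrite ger0_norm.
pose c z := Num.max 0 (Num.min 1 (k z)).
have c01 z : 0 <= c z <= 1.
  by rewrite /c le_max lexx /= ge_max ler01 ge_min lexx.
exists (g \o c); split.
- by apply: within01P => //; exact: continuous_clamp01.
- by move=> z; apply: Ag.
- move=> z Az; have [/andP[h0 h1] gh] := hP _ Az.
  by rewrite /= /c -hk ?inE // (min_idPr h1) (max_idPr h0).
Qed.

(* Otherwise the plane would retract onto the arc inside the bounded component
   and stay fixed outside, so that [p] would be missed. *)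
Lemma arc_complement_unbounded A a b p : is_arc A a b -> ~ A p ->
  ~ bounded_set (connected_component (~` A) p).
Proof.
move=> arcA nAp bU; have clA := arc_closed arcA.
have [r [cr rA rid]] := arc_retract arcA.
have oA : open (~` A) by exact: closed_openC.
set U := connected_component (~` A) p in bU.
have oU : open U by exact: component_open.
have Up : U p by exact: connected_component_refl.
have UA z : U z -> ~ A z by exact: connected_component_sub.
have [N N0 UN] := ex_strict_bound_gt0 bU.
pose F z := if pselect (U z) then r z else z.
have FU z : U z -> F z = r z by rewrite /F; case: pselect.
have FnU z : ~ U z -> F z = z by rewrite /F; case: pselect.
have cF : continuous F.
  move=> z B /=; have [Uz|nUz] := pselect (U z).
    rewrite FU // => /cr rB.
    apply: (@filterS _ (nbhs z) _ _ _ _ (filterI (open_nbhs_nbhs (conj oU Uz)) rB)).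
    by move=> w [Uw]; rewrite /= FU.
  (* On [A] both branches of [F] agree because [r] fixes [A]. Off [A] and [U], a whole neighbourhood
     avoids [U], since [U] is closed relative to the complement of [A]. *)
  rewrite FnU // => zB; have [Az|nAz] := pselect (A z).
    have := cr z B; rewrite rid // => /(_ zB) rB.
    by apply: (@filterS _ (nbhs z) _ _ _ _ (filterI zB rB)) => w [Bw Brw]; rewrite /= /F; case: pselect.
  have nclU : nbhs z (~` closure U).
    apply: open_nbhs_nbhs; split; first exact/closed_openC/closed_closure.
    by move=> clU; apply: nUz; apply: component_closure.
  apply: (@filterS _ (nbhs z) _ _ _ _ (filterI nclU zB)) => w [nUw Bw].
  by rewrite /= FnU // => /subset_closure.
(* The translation brings [p] to the origin. The radius used next adds the norm of [p] to [N], so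
   that the translated points stay out of [U]. *)
pose F' z := F (z + p) - p.
have [|||z] := @no_retraction R F' (N + `|p|).
- by rewrite ltr_wpDr.
- move=> z; apply: (@continuousD _ (R * R)%type _ (fun z => F (z + p)) (cst (- p))); last exact: cvg_cst.
  apply: (@continuous_comp _ _ _ (fun z => z + p) F); last exact: cF.
  by apply: (@continuousD _ (R * R)%type _ id (cst p)); [exact: cvg_id|exact: cvg_cst].
- move=> z Nz; rewrite /F' FnU ?addrK // => /UN /= zN.
  by have := ler_normB (z + p) p; rewrite addrK; lra.
rewrite /F' => /eqP; rewrite subr_eq0 => /eqP Fz.
have [Uz|nUz] := pselect (U (z + p)).
  by have := rA (z + p); rewrite -FU // Fz.
by move: (nUz); rewrite -(FnU _ nUz) Fz.
Qed.

Lemma within_comp01 (g : R -> R * R) (f : R -> R) (A : set R) :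
  {within `[0, 1], continuous g} -> continuous f ->
  (forall t, A t -> `[0, 1]%classic (f t)) -> {within A, continuous (g \o f)}.
Proof.
move=> cg cf f01; apply/subspace_continuousP => t At B gB.
have H := cf t _ ((subspace_continuousP _ _).1 cg (f t) (f01 t At) B gB).
by apply: (@filterS _ (nbhs t) _ _ _ _ H) => s Hs /f01 /Hs.
Qed.

(** Each arc is run through at double speed; injectivity across the two halves holds because the
    arcs share only [b]. *)
Lemma arc_concat A B a b c : is_arc A a b -> is_arc B b c ->
  A `&` B `<=` [set b] -> is_arc (A `|` B) a c.
Proof.
move=> [f [cf injf f0 f1 ->]] [g [cg injg g0 g1 ->]] AB.
pose h (t : R) := if t <= 2^-1 then f (2 * t) else g (2 * t - 1).
have h1 (t : R) : 0 <= t <= 1 -> t <= 2^-1 -> `[0, 1]%classic (2 * t) by rewrite /= in_itv /=; lra.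
have h2 (t : R) : 0 <= t <= 1 -> 2^-1 <= t -> `[0, 1]%classic (2 * t - 1) by rewrite /= in_itv /=; lra.
exists h; split.
- have -> : `[0%R, 1%R]%classic = `[0, 2^-1]%classic `|` `[2^-1, 1]%classic :> set R.
    apply/seteqP; split=> t /=; rewrite !in_itv /=; last by case; lra.
    by move=> t01; case: (leP t 2^-1) => H; [left|right]; lra.
  apply: withinU_continuous; try exact: itv_closed.
    apply: (@subspace_eq_continuous _ _ _ (f \o ( *%R 2))).
      move=> t; rewrite inE /= in_itv /= => /andP[_ t2].
      by have : h t = f (2 * t) by rewrite /h t2.
    apply: within_comp01 => //; first exact: mulrl_continuous.
    by move=> t; rewrite /= !in_itv /=; lra.
  apply: (@subspace_eq_continuous _ _ _ (g \o (fun t => 2 * t - 1))).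
    move=> t; rewrite inE /= in_itv /= => /andP[t2 t1].
    suff : h t = g (2 * t - 1) by [].
    rewrite /h; case: leP => // t2'; have -> : t = 2^-1 by lra.
    by rewrite divff // subrr f1 g0.
  apply: within_comp01 => //.
    move=> t; apply: (@continuousD R R^o R ( *%R 2) (cst (- 1))).
      exact: mulrl_continuous.
    exact: cvg_cst.
  by move=> t; rewrite /= !in_itv /=; lra.
- move=> s t; rewrite !in_itv /= => s01 t01.
  rewrite /h; case: leP => s2; case: leP => t2 E.
  + by have := injf _ _ _ _ E; rewrite !in_itv /= => H; have := H ltac:(lra) ltac:(lra); lra.
  (* The common value must be [b], which is [g 0], so that [t] would be one half, against the strict
     inequality. *)
  + have : (f @` `[0, 1] `&` g @` `[0, 1]) (f (2 * s)).
      split; first by exists (2 * s) => //; exact: h1.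
      by rewrite E; exists (2 * t - 1) => //; apply: h2; lra.
    move=> /AB /=; rewrite E -g0 => E'.
    by have := injg _ _ _ _ E'; rewrite !in_itv /= => H; have := H ltac:(lra) ltac:(lra); lra.
  + have : (f @` `[0, 1] `&` g @` `[0, 1]) (f (2 * t)).
      split; first by exists (2 * t) => //; exact: h1.
      by rewrite -E; exists (2 * s - 1) => //; apply: h2; lra.
    move=> /AB /=; rewrite -E -g0 => E'.
    by have := injg _ _ _ _ E'; rewrite !in_itv /= => H; have := H ltac:(lra) ltac:(lra); lra.
  + by have := injg _ _ _ _ E; rewrite !in_itv /= => H; have := H ltac:(lra) ltac:(lra); lra.
- by rewrite /h ifT ?mulr0 // invr_ge0.
- by rewrite /h ifF -?g1; [congr g; ring|apply/negbTE; lra].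
- apply/seteqP; split=> z.
    case=> [] [t + <-]; rewrite /= in_itv /= => t01.
      exists (t / 2); first by rewrite /= in_itv /=; lra.
      by rewrite /h ifT; [congr f; field|lra].
    have [->|t0] := eqVneq t 0.
      exists 2^-1; first by rewrite /= in_itv /=; lra.
      by rewrite /h lexx divff // f1 g0.
    have {}t0 : 0 < t by rewrite lt_neqAle eq_sym t0; case/andP: t01.
    exists ((t + 1) / 2); first by rewrite /= in_itv /=; lra.
    by rewrite /h ifF; [congr g; field|apply/negbTE; lra].
  move=> [t + <-]; rewrite /= in_itv /= => t01; rewrite /h; case: leP => t2.
    by left; exists (2 * t) => //; exact: h1.
  by right; exists (2 * t - 1) => //; apply: h2 => //; exact: ltW.
Qed.

End Arcs.

(** * Drawings of cycles *)

Definition steps (T : Type) (x : T) (p : seq T) : seq (T * T) := pairmap pair x p.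

(** Since [next] wraps around, the closing step from the last node to the first is included. *)
Definition csteps (T : eqType) (c : seq T) : seq (T * T) :=
  [seq (x, next c x) | x <- c].

Definition joins (T : eqType) (s : seq (T * T)) (x y : T) : bool :=
  ((x, y) \in s) || ((y, x) \in s).

Section Steps.
Context (T : finType).
Implicit Types (x y z : T) (p c : seq T).

Lemma csteps_cons x p : uniq (x :: p) -> csteps (x :: p) = steps x (rcons p x).
Proof.
suff aux y0 y q : uniq (y :: q) ->
    [seq (z, next_at z y0 y q) | z <- y :: q] = steps y (rcons q y0) by exact: aux.
elim: q y => [|w q IH] y; first by rewrite /= eqxx.
case/andP=> yNq uq.
have swap z : z \in w :: q -> next_at z y0 y (w :: q) = next_at z y0 w q.
  by move=> zq /=; case: eqP => // yz; rewrite -yz zq in yNq.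
rewrite map_cons (_ : map _ (w :: q) = [seq (z, next_at z y0 w q) | z <- w :: q]).
  by rewrite IH //= eqxx.
by apply/eq_in_map => z /swap ->.
Qed.

Lemma csteps_rot n c : uniq c -> csteps (rot n c) = rot n (csteps c).
Proof.
by move=> uc; rewrite /csteps -map_rot; apply: eq_map => x; rewrite next_rot.
Qed.

Lemma steps_cat x p q : steps x (p ++ q) = steps x p ++ steps (last x p) q.
Proof. exact: pairmap_cat. Qed.

Lemma steps_rcons x p y : steps x (rcons p y) = rcons (steps x p) (last x p, y).
Proof. by rewrite -cats1 steps_cat /= cats1. Qed.

Lemma mem_steps x p u v : (u, v) \in steps x p -> (u \in x :: p) && (v \in p).
Proof.
elim: p x => //= y p IH x; rewrite !inE => /orP[/eqP[-> ->]|/IH].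
  by rewrite !eqxx.
by rewrite !inE => /andP[-> ->]; rewrite !orbT.
Qed.

Lemma steps_path (r : rel T) x p u v : path r x p -> (u, v) \in steps x p -> r u v.
Proof.
elim: p x => //= y p IH x /andP[rxy py]; rewrite inE => /orP[/eqP[-> ->]|] //.
exact: IH.
Qed.

Lemma path_steps (r : rel T) x p :
  (forall u v, (u, v) \in steps x p -> r u v) -> path r x p.
Proof.
elim: p x => //= y p IH x H; rewrite H ?mem_head //=; apply: IH => u v uv.
by apply: H; rewrite inE uv orbT.
Qed.

Lemma circular_consP (r : rel T) x p : circular_path r (x :: p) <->
  [/\ path r x (rcons p x), uniq (x :: p) & (1 < size p)%N].
Proof.
rewrite /circular_path /ucycle; split=> [[/andP[? ?] ?]|[pr up sp]]; split=> //.
by apply/andP.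
Qed.

Lemma circular_rot (r : rel T) n c : circular_path r c -> circular_path r (rot n c).
Proof.
by case=> /andP[cc uc] sc; rewrite /circular_path /ucycle rot_cycle rot_uniq size_rot cc uc.
Qed.

Lemma circular_step (r : rel T) c u v :
  circular_path r c -> (u, v) \in csteps c -> r u v.
Proof.
by case=> /andP[cc uc] sc /mapP[x xc [-> ->]]; exact: next_cycle.
Qed.

Lemma circular_uniq (r : rel T) c : circular_path r c -> uniq c.
Proof. by case=> /andP[]. Qed.

Lemma mem_csteps c u v : (u, v) \in csteps c -> (u \in c) && (v \in c).
Proof. by case/mapP=> x xc [-> ->]; rewrite mem_next xc. Qed.

(** Cuts a cycle open at a chosen step: the rest is a simple path from [v] back to [u]. *)
Lemma csteps_rot_to (r : rel T) c u v : circular_path r c -> (u, v) \in csteps c ->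
  exists n p, [/\ rot n c = u :: v :: p, path r v (rcons p u),
    uniq (v :: rcons p u) & csteps (u :: v :: p) = (u, v) :: steps v (rcons p u)].
Proof.
move=> cc uv; have /andP[uc _] := mem_csteps uv.
have [n p' rotE] := rot_to uc.
have cr : circular_path r (u :: p') by rewrite -rotE; exact: circular_rot.
have : (u, v) \in csteps (u :: p').
  by rewrite -rotE csteps_rot ?mem_rot // (circular_uniq cc).
case/mapP=> _ _ [<- vE].
case/circular_consP: (cr); case: p' rotE cr vE => [|w p] rotE cr //.
rewrite /= eqxx => vw; rewrite -vw in rotE cr * => /andP[_ pv] uvp _.
exists n, p; split=> //.
  by have : uniq (rcons (v :: p) u) by rewrite rcons_uniq.
by rewrite csteps_cons // (circular_uniq cr).
Qed.

End Steps.

(** * A drawn cycle is an arc completed by an edge *)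

Section Drawing.
Context (R : realType) (T : finType) (e : rel T).
Hypotheses (e_sym : symmetric e) (e_irr : irreflexive e).
Variable emb : plane_embedding R e.
Implicit Types (x y z u v : T) (c p : seq T) (s : seq (T * T)) (q : R * R).

Definition draw s : set (R * R) :=
  [set q | exists2 uv, uv \in s & edge_curve emb uv.1 uv.2 q].

Definition open_edge x y : set (R * R) := edge_arc emb x y @` `]0, 1[.

(** A representative of the open edge. Testing it suffices, because an open edge is connected and
    misses every cycle that does not use the edge. *)
Definition midpoint x y : R * R := edge_arc emb x y 2^-1.

Lemma path_curveE c : path_curve emb c = draw (csteps c).
Proof.
apply/seteqP; split=> q; first by case=> x xc qx; exists (x, next c x); rewrite //= map_f.
by case=> _ /mapP[x xc ->] qx; exists x.
Qed.

Lemma path_curve_rot n c : uniq c -> path_curve emb (rot n c) = path_curve emb c.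
Proof.
move=> uc; rewrite !path_curveE csteps_rot //.
by apply/seteqP; split=> q [uv uvs quv]; exists uv; rewrite // mem_rot in uvs *.
Qed.

Lemma edge_curve_sym x y : e x y -> edge_curve emb y x = edge_curve emb x y.
Proof.
move=> exy; have sub u v : e u v -> edge_curve emb v u `<=` edge_curve emb u v.
  move=> euv _ [t t01 <-]; exists (1 - t); last by rewrite -edge_arc_sym ?inE.
  by move: t01; rewrite /= !in_itv /=; lra.
by apply/seteqP; split; apply: sub; rewrite // e_sym.
Qed.

Lemma edge_curve_is_arc x y : e x y ->
  is_arc (edge_curve emb x y) (node_pt emb x) (node_pt emb y).
Proof.
move=> exy; exists (edge_arc emb x y); split=> //.
- exact: edge_arc_continuous.
- exact: edge_arc_inj.
- exact: edge_arc0.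
- exact: edge_arc1.
Qed.

Lemma edge_curveE x y : e x y ->
  edge_curve emb x y = open_edge x y `|` [set node_pt emb x; node_pt emb y].
Proof.
move=> exy; apply/seteqP; split=> q.
  case=> t; rewrite /= in_itv /= => t01 <-.
  have [->|t0] := eqVneq t 0; first by right; left; rewrite /= edge_arc0.
  have [->|t1] := eqVneq t 1; first by right; right; rewrite /= edge_arc1.
  left; exists t => //; rewrite /= in_itv /=.
  by case/andP: t01; rewrite !le_eqVlt (negPf t1) eq_sym (negPf t0) /= => -> ->.
case=> [[t + <-]|[->|->]].
- by rewrite /= in_itv /= => t01; exists t => //; rewrite /= in_itv /=; lra.
- by exists 0; [rewrite /= in_itv /= lexx ler01|rewrite edge_arc0].
- by exists 1; [rewrite /= in_itv /= lexx ler01|rewrite edge_arc1].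
Qed.

Lemma open_edge_node x y z q : e x y -> open_edge x y q -> q <> node_pt emb z.
Proof. by move=> exy [t t01 <-]; apply: edge_arc_avoids_nodes. Qed.

Lemma node_edge_curve x y z : e x y -> edge_curve emb x y (node_pt emb z) ->
  z = x \/ z = y.
Proof.
move=> exy; rewrite edge_curveE // => -[/(open_edge_node exy)/(_ erefl) //|].
by case=> /node_pt_inj ->; [left|right].
Qed.

Lemma open_edge_draw x y s : e x y -> (forall u v, (u, v) \in s -> e u v) ->
  ~~ joins s x y -> open_edge x y `&` draw s = set0.
Proof.
move=> exy es nxy; apply/seteqP; split=> // q [oq [[u v] uvs /=]].
have euv := es _ _ uvs; rewrite edge_curveE // => -[|]; last first.
  by case=> /(open_edge_node exy oq).
case: oq => t t01 <- [t' t'01] /esym; apply: edge_arc_no_crossing => //.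
apply/eqP => E; case/negP: nxy; have := set21 x y; rewrite /joins.
have := set22 x y; rewrite E !inE => yuv xuv.
have xy : x != y by apply/eqP => xy; move: exy; rewrite xy e_irr.
case/orP: xuv yuv xy => /eqP-> /orP[]/eqP->; rewrite ?eqxx //= uvs ?orbT //.
Qed.

Lemma draw_node s z : (forall u v, (u, v) \in s -> e u v) ->
  draw s (node_pt emb z) -> exists2 uv, uv \in s & z = uv.1 \/ z = uv.2.
Proof.
move=> es [[u v] uvs /= zuv]; exists (u, v) => //=.
exact: node_edge_curve (es _ _ uvs) zuv.
Qed.

(** Edges are concatenated one by one; the first edge meets the rest only at [y] because [x] does
    not occur again. The path is nonempty since a single point is not an arc. *)
Lemma path_is_arc x p : path e x p -> uniq (x :: p) -> p != [::] ->
  is_arc (draw (steps x p)) (node_pt emb x) (node_pt emb (last x p)).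
Proof.
elim: p x => // y p IH x /= /andP[exy yp] /andP[xN uyp] _.
have [p0|p0] := eqVneq p [::].
  rewrite {}p0 /= in xN *; suff -> : draw [:: (x, y)] = edge_curve emb x y.
    exact: edge_curve_is_arc.
  apply/seteqP; split=> q; first by case=> _ /[!inE]/eqP->.
  by exists (x, y); rewrite // mem_head.
have es u v : (u, v) \in steps y p -> e u v by exact: steps_path.
have -> : draw ((x, y) :: steps y p) = edge_curve emb x y `|` draw (steps y p).
  apply/seteqP; split=> q.
    by case=> uv; rewrite inE => /orP[/eqP->|uvs] quv; [left|right; exists uv].
  case=> [qxy|[uv uvs quv]]; first by exists (x, y); rewrite ?mem_head.
  by exists uv; rewrite // inE uvs orbT.
apply: arc_concat (edge_curve_is_arc exy) (IH y yp uyp p0) _.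
move=> q [+ qs]; rewrite edge_curveE // => -[oq|[qx|//]].
  have : (open_edge x y `&` draw (steps y p)) q by [].
  rewrite open_edge_draw // /joins; apply/norP; split; apply/negP => /mem_steps.
    by case/andP=> xyp; rewrite xyp in xN.
  by case/andP=> _ xp; rewrite inE xp orbT in xN.
move: qs; rewrite qx => /(draw_node es)[[u v] /mem_steps/andP[uy vp] /=].
by case=> xE; case/negP: xN; rewrite xE ?uy // inE vp orbT.
Qed.

Lemma cycle_minus_edge (c : seq T) u v : circular_path e c -> (u, v) \in csteps c ->
  exists a b A, [/\ is_arc A a b, path_curve emb c = A `|` edge_curve emb u v,
    open_edge u v `&` A = set0, A (node_pt emb u) & A (node_pt emb v)].
Proof.
move=> cc uv; have euv := circular_step cc uv.
have [n [p [rotE vp uvp sE]]] := csteps_rot_to cc uv.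
have ucc := circular_uniq cc.
exists (node_pt emb v), (node_pt emb (last v (rcons p u))), (draw (steps v (rcons p u))).
have es x y : (x, y) \in steps v (rcons p u) -> e x y by exact: steps_path.
have mem_node x y : (x, y) \in steps v (rcons p u) ->
    draw (steps v (rcons p u)) (node_pt emb x) /\ draw (steps v (rcons p u)) (node_pt emb y).
  move=> xy; have exy := es _ _ xy.
  by split; exists (x, y); rewrite //= edge_curveE //; right; [left|right].
split.
- by apply: path_is_arc => //; case: (p).
- rewrite -(path_curve_rot n ucc) rotE path_curveE sE.
  apply/seteqP; split=> q.
    by case=> xy; rewrite inE => /orP[/eqP->|xys] qxy; [right|left; exists xy].
  case=> [[xy xys qxy]|qxy]; last by exists (u, v); rewrite ?mem_head.
  by exists xy; rewrite // inE xys orbT.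
- apply: open_edge_draw => //; apply/norP; split; apply/negP.
    have : uniq (rcons (v :: p) u) := uvp; rewrite rcons_uniq => /andP[uN _].
    rewrite steps_rcons mem_rcons inE => /orP[/eqP[_ vu]|/mem_steps].
      by move: euv; rewrite vu e_irr.
    by rewrite (negPf uN).
  (* The reverse step (v, u) could only come first on the remaining path, which the third node of
     the cycle prevents. *)
  have := cc.2; rewrite -(size_rot n) rotE; case: (p) uvp => // w p' uvp _.
  rewrite [steps _ _]/= inE => /orP[/eqP[uw]|/mem_steps/andP[vin _]].
    by case/and3P: uvp => _; rewrite uw mem_rcons mem_head.
  by case/andP: uvp; rewrite vin.
- have : (last v p, u) \in steps v (rcons p u) by rewrite steps_rcons mem_rcons mem_head.
  by move/mem_node => [].
- have : exists w, (v, w) \in steps v (rcons p u).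
    by case: (p) => [|w p']; [exists u|exists w]; rewrite mem_head.
  by move=> [w /mem_node[]].
Qed.

End Drawing.

Lemma bounded_setS (R : realType) (A B : set (R * R)) :
  A `<=` B -> bounded_set B -> bounded_set A.
Proof.
move=> AB; apply: sub_boundedr => P BP x Ax; exact: BP (AB x Ax).
Qed.

(** * Interior and exterior of a drawn cycle *)

Section Surround.
Context (R : realType) (T : finType) (e : rel T).
Hypotheses (e_sym : symmetric e) (e_irr : irreflexive e).
Variable emb : plane_embedding R e.
Implicit Types (x y u v : T) (c : seq T) (p q z : R * R).

Notation comp c := (connected_component (~` path_curve emb c)).

Lemma path_curve_compact c : circular_path e c -> compact (path_curve emb c).
Proof.
move=> cc; case: c cc => [[]//|u c cc].
have uv : (u, next (u :: c) u) \in csteps (u :: c) by rewrite map_f ?mem_head.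
have [a [b [A [/arc_compact cA -> _ _ _]]]] := cycle_minus_edge e_irr emb cc uv.
by apply: compactU => //; exact: arc_compact (edge_curve_is_arc emb (circular_step cc uv)).
Qed.

Lemma path_curve_open c : circular_path e c -> open (~` path_curve emb c).
Proof.
move=> cc; apply: closed_openC; apply: compact_closed (path_curve_compact cc).
exact: (@norm_hausdorff R (R * R)%type).
Qed.

Lemma surrounds_component c p q : comp c p q ->
  surrounds emb c p -> surrounds emb c q.
Proof.
move=> pq [nc bd]; split; first exact: connected_component_sub pq.
by rewrite -(same_connected_component pq).
Qed.

Lemma surrounds_connected c (S : set (R * R)) p q : connected S ->
  S `&` path_curve emb c = set0 -> S p -> S q ->
  surrounds emb c p -> surrounds emb c q.
Proof.
move=> cS S0 Sp Sq; apply: surrounds_component; exists S => //; split=> //.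
by move=> x Sx cx; have : (S `&` path_curve emb c) x by []; rewrite S0.
Qed.

(** If the component is not adherent to the part of [E] that lies off [A], erasing [E] does not
    enlarge it: it is both open and closed in the larger component. *)
Lemma component_minus_edge (A E E' : set (R * R)) p :
  closed A -> closed (A `|` E) -> E `<=` A `|` E' ->
  ~ (A `|` E) p -> closure (connected_component (~` (A `|` E)) p) `&` E' = set0 ->
  connected_component (~` A) p = connected_component (~` (A `|` E)) p.
Proof.
move=> clA clAE EA np clE'; set K := connected_component (~` (A `|` E)) p in clE' *.
set K2 := connected_component _ _.
have oAE : open (~` (A `|` E)) by exact: closed_openC.
have Kp : K p by exact: connected_component_refl.
have KK2 : K `<=` K2.
  apply: connected_component_max => //; last exact: component_connected.
  by move=> x /connected_component_sub nx Ax; apply: nx; left.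
apply/esym; apply: (component_connected (A := ~` A) (x := p)).
- by exists p.
- exists K; first exact: component_open.
  by rewrite setIidr.
- exists (closure K); first exact: closed_closure.
  apply/seteqP; split=> x; first by move=> Kx; split; [exact: KK2|exact: subset_closure].
  move=> [/connected_component_sub nAx clx]; apply: component_closure => //; split=> // -[//|].
  move=> /EA[//|E'x]; have : (closure K `&` E') x by [].
  by rewrite clE'.
Qed.

(** Otherwise the edge could be erased without changing the bounded component, and the remaining arc
    would have a bounded complementary component. *)
Lemma inner_boundary c p u v : circular_path e c -> surrounds emb c p ->
  (u, v) \in csteps c -> exists2 x : R * R, open_edge emb u v x & closure (comp c p) x.
Proof.
move=> cc [np bd] uv; apply: contrapT => none.
have [a [b [A [arcA cE oA Au Av]]]] := cycle_minus_edge e_irr emb cc uv.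
have clA := arc_closed arcA; have euv := circular_step cc uv.
have clc : closed (path_curve emb c) by rewrite -openC; exact: path_curve_open.
rewrite cE in np bd none clc.
apply: (@arc_complement_unbounded _ A a b p arcA).
  by move=> Ap; apply: np; left.
rewrite (component_minus_edge (E := edge_curve emb u v) (E' := open_edge emb u v)) //.
- by rewrite edge_curveE // => x [|[->|->]]; [right|left|left].
- by apply/seteqP; split=> // x [clx ox]; apply: none; exists x.
Qed.

(* The exterior of a bounded curve contains the complement of a square, which is
   connected. *)
Lemma outer_boundary c p u v : circular_path e c -> surrounds emb c p ->
  (u, v) \in csteps c -> exists (x : R * R) q, [/\ open_edge emb u v x, ~ path_curve emb c q,
    ~ bounded_set (comp c q) & closure (comp c q) x].
Proof.
move=> cc surp uv; have [np bd] := surp.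
have [N N0 cN] := ex_strict_bound_gt0 (compact_bounded (path_curve_compact cc)).
have out z : N < `|z| -> ~ path_curve emb c z.
  by move=> Nz /cN /= zN; have := lt_trans Nz zN; rewrite ltxx.
pose pt (m : R) : R * R := (m, 0).
have npt (m : R) : 0 < m -> `|pt m| = m.
  by move=> m0; rewrite prod_normE /= normr0 gtr0_norm // max_l // ltW.
pose q := pt (N + 1).
have qN : N < `|q| by rewrite npt ?ltrDl // addr_gt0.
have qz z : N < `|z| -> comp c q z by move=> zN; apply: (@outside_component R _ N) => //; exact: ltW.
have ub : ~ bounded_set (comp c q).
  move=> /ex_strict_bound_gt0[M M0 MU]; have NM : 0 < N + M by rewrite addr_gt0.
  have /qz /MU /= : N < `|pt (N + M)| by rewrite npt // ltrDl.
  by rewrite npt //; lra.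
apply: contrapT => none.
have {}none : closure (comp c q) `&` open_edge emb u v = set0.
  by apply/seteqP; split=> // x [clx ox]; apply: none; exists x, q; split=> //; exact: out.
have [a [b [A [arcA cE oA Au Av]]]] := cycle_minus_edge e_irr emb cc uv.
have clA := arc_closed arcA; have euv := circular_step cc uv.
have clc : closed (path_curve emb c) by rewrite -openC; exact: path_curve_open.
have nq := out q qN.
have compE : connected_component (~` A) q = comp c q.
  rewrite cE in none clc nq *; apply: component_minus_edge none => //.
  by rewrite edge_curveE // => x [|[->|->]]; [right|left|left].
have nAp : ~ A p by move=> Ap; apply: np; rewrite cE; left.
(* The component of [p] off the arc is bounded by [N]: a farther point in it would connect [p] to
   the exterior of [c]. *)
have := arc_complement_unbounded arcA nAp; apply.
exists N; split; first exact: num_real.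
move=> M NM z /= pz; rewrite leNgt; apply/negP => /(lt_trans NM)/qz qz'.
have : comp c q p.
  rewrite -compE in qz' *; apply: (connected_component_trans qz').
  exact: connected_component_sym.
by move=> /connected_component_sym/surrounds_component/(_ surp)[_ /ub].
Qed.

Lemma open_edge_connected x y : e x y -> connected (open_edge emb x y).
Proof.
move=> exy; apply: connected_continuous_connected.
  by apply/connected_intervalP; exact: interval_is_interval.
apply: continuous_subspaceW (edge_arc_continuous (p := emb) exy).
by apply: subset_itv; rewrite bnd_simp.
Qed.

Lemma midpoint_open x y : open_edge emb x y (midpoint emb x y).
Proof. by exists 2^-1 => //; rewrite /= in_itv /=; lra. Qed.

Lemma open_edge_curve x y : open_edge emb x y `<=` edge_curve emb x y.
Proof. by move=> q [t + <-]; rewrite /= in_itv /= => t01; exists t; rewrite //= in_itv /=; lra. Qed.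

Lemma open_edge_sym x y : e x y -> open_edge emb x y = open_edge emb y x.
Proof.
move=> exy; have sub u v : e u v -> open_edge emb u v `<=` open_edge emb v u.
  move=> euv _ [t + <-]; rewrite /= in_itv /= => t01.
  exists (1 - t); first by rewrite /= in_itv /=; lra.
  rewrite edge_arc_sym // ?in_itv /=; last by lra.
  by congr edge_arc; ring.
by apply/seteqP; split; apply: sub; rewrite // e_sym.
Qed.

Lemma joins_csteps_edge c x y : circular_path e c -> joins (csteps c) x y -> e x y.
Proof. by move=> cc /orP[/(circular_step cc)|/(circular_step cc)] //; rewrite e_sym. Qed.

Lemma joins_path_curve c x y : circular_path e c -> joins (csteps c) x y ->
  edge_curve emb x y `<=` path_curve emb c.
Proof.
move=> cc /orP[] xy q qxy; rewrite path_curveE; first by exists (x, y).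
have exy : e x y by rewrite e_sym (circular_step cc xy).
by exists (y, x); rewrite //= (edge_curve_sym e_sym emb exy).
Qed.

Lemma open_edge_cycle c x y : circular_path e c -> e x y -> ~~ joins (csteps c) x y ->
  open_edge emb x y `&` path_curve emb c = set0.
Proof.
by move=> cc exy nxy; rewrite path_curveE; apply: open_edge_draw => // u v; exact: circular_step.
Qed.

(** The curve of [c1] misses the unbounded components of the complement of [c], so these lie outside
    [c1] as well. The delicate case is a midpoint on [c] itself, settled by the adherence of the
    edges of [c] to its exterior. *)
Lemma sub_surrounds c c1 p0 x y : circular_path e c -> circular_path e c1 ->
  surrounds emb c p0 ->
  path_curve emb c1 `<=` path_curve emb c `|` surrounds emb c ->
  e x y -> surrounds emb c1 (midpoint emb x y) -> surrounds emb c (midpoint emb x y).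
Proof.
move=> cc cc1 surp0 c1c exy sur1.
have unb q : ~ path_curve emb c q -> ~ bounded_set (comp c q) ->
    comp c q `<=` ~` path_curve emb c1.
  move=> nq ub z qz /c1c[cz|surz]; first by have := connected_component_sub qz.
  by case: (surrounds_component (connected_component_sym qz) surz).
have far q : ~ path_curve emb c q -> ~ path_curve emb c1 q ->
    ~ bounded_set (comp c q) -> ~ surrounds emb c1 q.
  move=> nq nq1 ub [_ bd1]; apply: (ub); apply: bounded_setS bd1.
  apply: connected_component_max; last exact: component_connected.
    exact: connected_component_refl.
  exact: unb.
have [nm1 _] := sur1.
have [cm|ncm] := pselect (path_curve emb c (midpoint emb x y)); last first.
  by split=> //; apply: contrapT => ub; exact: (far _ ncm nm1 ub sur1).
have [jc|njc] := boolP (joins (csteps c) x y); last first.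
  have : (open_edge emb x y `&` path_curve emb c) (midpoint emb x y).
    by split=> //; exact: midpoint_open.
  by rewrite open_edge_cycle.
have njc1 : ~~ joins (csteps c1) x y.
  apply/negP => /(joins_path_curve cc1)/(_ (midpoint emb x y)); apply: contra_not nm1.
  by apply; apply: open_edge_curve; exact: midpoint_open.
(* Here the edge belongs to [c] but not to [c1]: exterior points of [c] near [z] would be surrounded
   by [c1], against [far]. *)
have [z [q [oz nq ub clz]]] : exists (z : R * R) q, [/\ open_edge emb x y z, ~ path_curve emb c q,
    ~ bounded_set (comp c q) & closure (comp c q) z].
  case/orP: jc => uv; first exact: outer_boundary surp0 uv.
  by rewrite open_edge_sym //; exact: outer_boundary surp0 uv.
have oc1 := open_edge_cycle cc1 exy njc1.
have nc1z : ~ path_curve emb c1 z.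
  by move=> c1z; have : (open_edge emb x y `&` path_curve emb c1) z by []; rewrite oc1.
have surz := surrounds_connected (open_edge_connected exy) oc1 (midpoint_open x y) oz sur1.
have [r r0 [rc1 _]] := component_ball z (path_curve_open cc1) nc1z.
have [w [qw zw]] := clz _ (nbhsx_ballx z r r0).
have surw := surrounds_component (ball_component rc1 zw) surz.
have := same_connected_component qw; have [nw _] := surw => qwE.
have ncw : ~ path_curve emb c w by have := connected_component_sub qw.
have ubw : ~ bounded_set (comp c w) by rewrite -qwE.
by have := far w ncw nw ubw surw.
Qed.

End Surround.

(** * Elementary polygons generate the cycle space *)

(** The nodes of [S] remain as isolated nodes, so the type and the embedding do not change. *)
Definition del (T : finType) (e : rel T) (S : {set T}) : rel T :=
  [rel u v | [&& e u v, u \notin S & v \notin S]].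

(** For a symmetric [k], seen as a set of edges, this is a linear form over the field with two
    elements. *)
Definition parity (T : Type) (k : rel T) (s : seq (T * T)) : bool :=
  \big[addb/false]_(uv <- s) k uv.1 uv.2.

(** * Parities of walks, and cycles glued from two paths *)

Section Parity.
Context (T : finType).
Implicit Types (x y : T) (p c : seq T) (k r : rel T).

Lemma parity_cat k (s t : seq (T * T)) : parity k (s ++ t) = parity k s (+) parity k t.
Proof. exact: big_cat. Qed.

Lemma parity_cons k x y (s : seq (T * T)) :
  parity k ((x, y) :: s) = k x y (+) parity k s.
Proof. exact: big_cons. Qed.

Lemma parity_rot k n (s : seq (T * T)) : parity k (rot n s) = parity k s.
Proof. by apply: perm_big; rewrite perm_rot. Qed.

Lemma steps_rev x p :
  steps (last x p) (rev (belast x p)) = rev [seq (uv.2, uv.1) | uv <- steps x p].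
Proof.
elim/last_ind: p => //= p y IH.
rewrite last_rcons belast_rcons lastI rev_rcons steps_rcons map_rcons rev_rcons /=.
by rewrite IH.
Qed.

Lemma steps_rev_rcons x p y :
  steps y (rcons (rev p) x) = rev [seq (uv.2, uv.1) | uv <- steps x (rcons p y)].
Proof. by rewrite -steps_rev last_rcons belast_rcons rev_cons. Qed.

Lemma parity_rev k x p y : symmetric k ->
  parity k (steps y (rcons (rev p) x)) = parity k (steps x (rcons p y)).
Proof.
move=> ks; rewrite steps_rev_rcons /parity.
rewrite (perm_big [seq (uv.2, uv.1) | uv <- steps x (rcons p y)]); last by rewrite perm_rev.
by rewrite big_map; apply: eq_bigr => uv _; rewrite ks.
Qed.

Lemma connect_exit r (X : {pred T}) x y : connect r x y -> x \in X -> y \notin X ->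
  exists u v, [/\ r u v, u \in X & v \notin X].
Proof.
case/connectP=> p; elim: p x => [|z p IH] x /=; first by move=> _ -> ->.
move=> /andP[xz zp] yE xX yX; have [zX|zX] := boolP (z \in X); first exact: IH zp yE zX yX.
by exists x, z.
Qed.

Lemma rcons_theta (x y : T) p q : rcons (p ++ y :: q) x = rcons p y ++ rcons q x.
Proof. by rewrite rcons_cat rcons_cons cat_rcons. Qed.

Lemma uniq_theta (s t q : seq T) x : uniq (s ++ x :: t) -> uniq q ->
  (forall z, z \in q -> z \notin s ++ x :: t) -> uniq (s ++ x :: q).
Proof.
rewrite !cat_uniq => /and3P[us /hasPn st _] uq qN; rewrite us /= uq andbT.
apply/andP; split; last by apply/negP => /qN; rewrite mem_cat mem_head orbT.
apply/norP; split; first exact: st (mem_head _ _).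
by apply/hasPn => z /qN; rewrite mem_cat => /norP[].
Qed.

Lemma circular_theta r x y p q :
  path r x (rcons p y) -> path r y (rcons q x) -> uniq (x :: p ++ y :: q) ->
  (0 < size p + size q)%N ->
  circular_path r (x :: p ++ y :: q) /\
  csteps (x :: p ++ y :: q) = steps x (rcons p y) ++ steps y (rcons q x).
Proof.
move=> px qy u s.
split; last by rewrite csteps_cons // rcons_theta steps_cat last_rcons.
apply/circular_consP; split=> //; first by rewrite rcons_theta cat_path last_rcons px.
by rewrite size_cat /= addnS ltnS.
Qed.

End Parity.

(** * Splitting cycles along inner paths *)

Section Generation.
Context (R : realType) (T : finType) (e : rel T).
Hypotheses (e_sym : symmetric e) (e_irr : irreflexive e).
Variable emb : plane_embedding R e.
Hypothesis conn : four_connected e.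
Variable S : {set T}.
Hypothesis S1 : (#|S| <= 1)%N.
Implicit Types (x y u v : T) (c p : seq T) (q : R * R) (k : rel T).

Notation d := (del e S).

(** The counterpart of an elementary polygon for the graph without [S], in the same drawing: the
    node of [S] and its edges may be surrounded. *)
Definition tight c : Prop := circular_path d c /\
  forall x y q, d x y -> edge_curve emb x y q -> ~ surrounds emb c q.

Lemma del_e x y : d x y -> e x y.
Proof. by case/and3P. Qed.

Lemma del_sym : symmetric d.
Proof. by move=> x y; rewrite /del /= e_sym [(x \notin S) && _]andbC. Qed.

Lemma circular_del c : circular_path d c -> circular_path e c.
Proof.
case=> /andP[cc uc] sc; split=> //; apply/andP; split=> //.
by apply: sub_cycle cc => x y; exact: del_e.
Qed.

Lemma node_path_curve c x : circular_path e c ->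
  path_curve emb c (node_pt emb x) -> x \in c.
Proof.
move=> cc; rewrite path_curveE => /draw_node[u v|[u v] /mem_csteps/andP[uc vc] /=].
  exact: circular_step.
by case=> ->.
Qed.

Lemma path_curve_node c x : circular_path e c -> x \in c ->
  path_curve emb c (node_pt emb x).
Proof.
move=> cc xc; exists x => //; rewrite edge_curveE; first by right; left.
by apply: (circular_step cc); exact: map_f.
Qed.

Lemma joins_mem c x y : joins (csteps c) x y -> (x \in c) && (y \in c).
Proof. by case/orP=> /mem_csteps // ; rewrite andbC. Qed.

(** The edge without its end [y] is connected and misses the cycle, even when [y] is on the
    cycle. *)
Lemma half_edge c x y q : circular_path e c -> e x y -> x \notin c ->
  open_edge emb x y q ->
  surrounds emb c (node_pt emb x) <-> surrounds emb c q.
Proof.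
move=> cc exy xc [t + <-]; rewrite /= in_itv /= => t01.
have cS : connected (edge_arc emb x y @` `[0, 1[).
  apply: connected_continuous_connected.
    by apply/connected_intervalP; exact: interval_is_interval.
  apply: continuous_subspaceW (edge_arc_continuous (p := emb) exy).
  by apply: subset_itv; rewrite bnd_simp.
have S0 : edge_arc emb x y @` `[0, 1[ `&` path_curve emb c = set0.
  apply/seteqP; split=> // _ [[s + <-] cs]; rewrite /= in_itv /= => /andP[s0 s1].
  have [s0'|s0'] := eqVneq s 0.
    by move: cs; rewrite s0' edge_arc0 // => /(node_path_curve cc); apply/negP.
  have : (open_edge emb x y `&` path_curve emb c) (edge_arc emb x y s).
    by split=> //; exists s; rewrite //= in_itv /= s1 lt_neqAle eq_sym s0' s0.
  by rewrite open_edge_cycle //; apply: contra xc => /joins_mem/andP[].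
have Sx : (edge_arc emb x y @` `[0, 1[) (node_pt emb x).
  by exists 0; rewrite ?edge_arc0 //= in_itv /= lexx ltr01.
have Sq : (edge_arc emb x y @` `[0, 1[) (edge_arc emb x y t).
  by exists t; rewrite //= in_itv /=; lra.
by split; apply: surrounds_connected cS S0 _ _.
Qed.

Lemma surrounds_neighbor c x y : circular_path e c -> e x y -> x \notin c -> y \notin c ->
  surrounds emb c (node_pt emb x) -> surrounds emb c (node_pt emb y).
Proof.
move=> cc exy xc yc; rewrite (half_edge cc exy xc (midpoint_open emb x y)).
rewrite (half_edge cc _ yc (_ : open_edge emb y x (midpoint emb x y))) //.
  by rewrite e_sym.
by rewrite -open_edge_sym //; exact: midpoint_open.
Qed.

(** When [p] is empty this is a chord drawn inside the cycle. *)
Definition inner_path c x p y : Prop :=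
  [/\ x \in c, y \in c, x != y, path d x (rcons p y) &
   [/\ uniq p, forall z, z \in p -> z \notin c &
    forall u v, (u, v) \in steps x (rcons p y) ->
      open_edge emb u v `<=` surrounds emb c]].

(** The component of [x] in the graph without [S] and [c] stays inside [c]. By connectivity it is
    attached to [c] at two distinct nodes, and a path through the component joins them. *)
Lemma inner_path_node c x : circular_path d c -> x \notin S -> x \notin c ->
  surrounds emb c (node_pt emb x) -> exists a p b, inner_path c a p b.
Proof.
move=> cd xS xc sx; have cc := circular_del cd.
pose r := [rel u v | [&& d u v, u \notin c & v \notin c]].
have rsym : connect_sym r.
  by apply: sym_connect_sym => u v; rewrite /r /= del_sym [(u \notin c) && _]andbC.
have inX z : connect r x z -> [/\ z \notin c, z \notin S & surrounds emb c (node_pt emb z)].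
  case/connectP=> p; elim/last_ind: p z => [|p w IH] z; first by move=> _ ->.
  rewrite rcons_path last_rcons => /andP[xp /and3P[/and3P[elw lS wS] lc wc]] ->.
  by split=> //; have [_ _] := IH _ xp erefl; exact: surrounds_neighbor.
(* A walk from [x] to a node of [c] that avoids [S'] leaves the component of [x], and can do so only
   through a node of [c]. *)
have out (S' : {set T}) y : S \subset S' -> (#|S'| < 4)%N -> x \notin S' -> y \in c ->
    y \notin S' -> exists u v, [/\ connect r x u, d u v, v \in c & v \notin S'].
  move=> SS' S'4 xS' yc yS'.
  have := conn S'4 xS' yS' => /connect_exit/(_ (connect0 r x)); case.
    by apply/negP => /inX[]; rewrite yc.
  move=> u [v [/and3P[euv uS' vS'] xu xv]]; exists u, v; split=> //.
    by rewrite /del /= euv /=; apply/andP; split; [apply: contra uS'|apply: contra vS']; exact: (fintype.subsetP SS').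
  apply: contraR xv => vc; apply: (connect_trans xu); apply: connect1.
  have [uc uS _] := inX _ xu.
  by rewrite /r /del /= euv uc uS vc !andbT; apply: contra vS'; exact: (fintype.subsetP SS').
have cS z : z \in c -> z \notin S.
  by move=> zc; have /(circular_step cd)/and3P[] := map_f (fun x => (x, next c x)) zc.
have [y0 y0c] : exists y0, y0 \in c.
  by case: cd => _; case: (c) => // y0 c' _; exists y0; exact: mem_head.
have [u [a [xu ua ac _]]] := out S y0 (fintype.subxx _) (leq_ltn_trans S1 (isT : (1 < 4)%N)) xS y0c (cS _ y0c).
have [y1 y1c y1a] : exists2 y1, y1 \in c & y1 != a.
  exists (next c a); rewrite ?mem_next //; apply/eqP => E.
  have /(circular_step cc) := map_f (fun x => (x, next c x)) ac.
  by rewrite E e_irr.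
have aS := cS a ac.
(* Deleting the first attachment [a] together with [S] removes at most two nodes, so there is a
   second attachment. *)
have [||||v [b [xv vb bc]]] := out (a |: S)%SET y1 _ _ _ y1c _.
- exact: finset.subsetUr.
- by rewrite cardsU1 (leq_ltn_trans (leq_add (leq_b1 _) S1) (isT : (1 + 1 < 4)%N)).
- by rewrite !inE negb_or xS andbT; apply: contraNneq xc => ->.
- by rewrite !inE negb_or y1a cS.
rewrite !inE negb_or => /andP[ba _].
have : connect r u v by apply: connect_trans xv; rewrite rsym.
case/connectP=> p0 /shortenP[p up uniqp _ vE].
have pX z : z \in u :: p -> connect r x z.
  by move=> zp; apply: (connect_trans xu); by move: (path_connect up); apply.
exists a, (u :: p), b; split=> //; first by rewrite eq_sym.
  rewrite rcons_cons /= del_sym ua rcons_path -vE vb andbT /=.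
  by apply: sub_path up => w z /and3P[].
split=> //; first by move=> z /pX/inX[].
move=> w z; rewrite rcons_cons [steps _ _]/= inE => wz q oq.
have [uc _ su] := inX _ xu.
case/orP: wz => [/eqP[wa zu]|wz].
  have eau : e a u by rewrite e_sym (del_e ua).
  move: oq; rewrite wa zu (open_edge_sym e_sym emb eau) => oq.
  by apply/(half_edge cc (del_e ua) uc oq).
have wp : w \in u :: p.
  by move: wz; rewrite steps_rcons mem_rcons inE => /orP[/eqP[-> _]|/mem_steps/andP[]//]; exact: mem_last.
have ewz : e w z.
  move: wz; apply: steps_path; rewrite rcons_path -vE (del_e vb) andbT.
  by apply: sub_path up => ? ? /and3P[/del_e].
have [wc _ sw] := inX _ (pX _ wp).
by apply/(half_edge cc ewz wc oq).
Qed.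

(** Take an edge with a surrounded point. If an end is off [c], that end is surrounded and
    [inner_path_node] applies; otherwise the edge is a chord. *)
Lemma inner_path_exists c : circular_path d c -> ~ tight c ->
  exists a p b, inner_path c a p b.
Proof.
move=> cd nt; have cc := circular_del cd.
have [x [y [q [dxy qxy sq]]]] : exists x y q,
    [/\ d x y, edge_curve emb x y q & surrounds emb c q].
  apply: contrapT => none; apply: nt; split=> // x y q dxy qxy sq.
  by apply: none; exists x, y, q.
have exy := del_e dxy; have /and3P[_ xS yS] := dxy; have [nq _] := sq.
have node z : z \notin S -> surrounds emb c (node_pt emb z) ->
    exists a p b, inner_path c a p b.
  move=> zS sz; apply: (inner_path_node cd zS _ sz).
  by apply/negP => zc; case: sz => + _; apply; exact: path_curve_node.
move: (qxy); rewrite edge_curveE // => -[oq|[qE|qE]]; last 2 first.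
- by apply: (node x) => //; rewrite -qE.
- by apply: (node y) => //; rewrite -qE.
have [xc|xc] := boolP (x \in c); last first.
  by apply: (node x) => //; apply/(half_edge cc exy xc oq).
have [yc|yc] := boolP (y \in c); last first.
  have eyx : e y x by rewrite e_sym.
  have oq' : open_edge emb y x q by rewrite (open_edge_sym e_sym emb eyx).
  by apply: (node y) => //; apply/(half_edge cc eyx yc oq').
have nj : ~~ joins (csteps c) x y.
  by apply/negP => /(joins_path_curve e_sym cc)/(_ _ qxy).
exists x, [::], y; split=> //=; first by apply: contraTneq exy => ->; rewrite e_irr.
  by rewrite dxy.
split=> // u v; rewrite inE => /eqP[-> ->] z oz.
exact: (surrounds_connected (open_edge_connected exy) (open_edge_cycle e_irr emb cc exy nj) oq oz sq).
Qed.

(** The cardinal of this set is the measure of the induction; each edge is counted in both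
    orientations. *)
Definition inner_edges c : {set T * T} :=
  [set uv | d uv.1 uv.2 && `[< surrounds emb c (midpoint emb uv.1 uv.2) >]].

Lemma inner_edges_lt c c1 u v : circular_path d c -> circular_path d c1 ->
  path_curve emb c1 `<=` path_curve emb c `|` surrounds emb c ->
  d u v -> joins (csteps c1) u v -> surrounds emb c (midpoint emb u v) ->
  (#|inner_edges c1| < #|inner_edges c|)%N.
Proof.
move=> /circular_del cc /circular_del cc1 sub duv juv sm; apply: proper_card.
apply/properP; split; last first.
  exists (u, v); rewrite inE /= duv /=; first exact/asboolP.
  apply/asboolP => -[+ _]; apply.
  by apply: (joins_path_curve e_sym cc1 juv); apply: open_edge_curve; exact: midpoint_open.
apply/fintype.subsetP => -[x y]; rewrite !inE /= => /andP[dxy /asboolP sx].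
rewrite dxy; apply/asboolP.
exact: (sub_surrounds e_sym e_irr cc cc1 sm sub (del_e dxy)).
Qed.

(** The inner path and the two arcs of [c] form a theta graph. The inner path is used by both new
    cycles and cancels in the sum; its first edge is surrounded by [c] but by neither of them. *)
Lemma split_cycle c a p b : circular_path d c -> inner_path c a p b ->
  exists c1 c2, [/\ circular_path d c1, circular_path d c2,
    (#|inner_edges c1| < #|inner_edges c|)%N, (#|inner_edges c2| < #|inner_edges c|)%N &
    forall k, symmetric k ->
      parity k (csteps c) = parity k (csteps c1) (+) parity k (csteps c2)].
Proof.
move=> cd [ac bc ab dp [up pc sp]]; have cc := circular_del cd.
have uc := circular_uniq cd.
have [n p1 p2 _ _ rotE] := rot_to_arc uc ac bc ab.
have := circular_rot n cd; rewrite rotE => cr.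
have csE : csteps (a :: p1 ++ b :: p2) = steps a (rcons p1 b) ++ steps b (rcons p2 a).
  rewrite csteps_cons; last exact: circular_uniq cr.
  by rewrite rcons_theta steps_cat last_rcons.
case/circular_consP: (cr); rewrite rcons_theta cat_path last_rcons.
move=> /andP[d1 d2] u12 s12.
have dr : path d b (rcons (rev p) a).
  apply: path_steps => u v; rewrite steps_rev_rcons mem_rev => /mapP[[x y] xy [-> ->]] /=.
  by rewrite del_sym; exact: (steps_path dp xy).
have pc' z : z \in c = (z \in a :: p1 ++ b :: p2) by rewrite -rotE mem_rot.
have nj x y : (x, y) \in steps a (rcons p b) -> ~~ joins (csteps c) x y.
  move=> xy; apply/negP => /(joins_path_curve e_sym cc)/(_ (midpoint emb x y)) H.
  have [+ _] := sp _ _ xy _ (midpoint_open emb x y); apply; apply: H.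
  by apply: open_edge_curve; exact: midpoint_open.
have cstepsE xy : xy \in csteps c = (xy \in csteps (a :: p1 ++ b :: p2)).
  by rewrite -rotE csteps_rot // mem_rot.
have curveP x y : joins (steps a (rcons p b)) x y ->
    edge_curve emb x y `<=` path_curve emb c `|` surrounds emb c.
  move=> jxy; have exy : e x y.
    by case/orP: jxy => /(steps_path dp)/del_e //; rewrite e_sym.
  have eyx : e y x by rewrite e_sym.
  have oxy : open_edge emb x y `<=` surrounds emb c.
    by case/orP: jxy => [|yx]; [exact: sp|rewrite (open_edge_sym e_sym emb exy); exact: sp].
  have mxy := midpoint_open emb x y.
  have myx : open_edge emb y x (midpoint emb x y) by rewrite (open_edge_sym e_sym emb eyx).
  rewrite edge_curveE // => z [/oxy|[->|->]]; first by right.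
    have [xc|xc] := boolP (x \in c); first by left; exact: path_curve_node.
    by right; apply/(half_edge cc exy xc mxy); exact: oxy.
  have [yc|yc] := boolP (y \in c); first by left; exact: path_curve_node.
  by right; apply/(half_edge cc eyx yc myx); exact: oxy.
have [w aw] : exists w, (a, w) \in steps a (rcons p b).
  by case: (p) => [|w p']; [exists b|exists w]; exact: mem_head.
have join_lt c1 (q : seq (T * T)) : circular_path d c1 ->
    {subset csteps c1 <= q ++ steps a (rcons p b) ++ steps b (rcons (rev p) a)} ->
    joins (csteps c1) a w -> {subset q <= csteps c} ->
    (#|inner_edges c1| < #|inner_edges c|)%N.
  move=> cd1 c1E jaw qc; have daw : d a w := steps_path dp aw.
  apply: (inner_edges_lt cd cd1 _ daw) => //; last exact: sp aw _ (midpoint_open emb a w).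
  move=> z; rewrite [in X in X -> _]path_curveE => -[[x y] /c1E + /= zxy].
  rewrite !mem_cat => /orP[xyq|xyp].
    by left; rewrite path_curveE; exists (x, y) => //; exact: qc.
  apply: curveP zxy; case/orP: xyp => [|]; first by rewrite /joins => ->.
  by rewrite steps_rev_rcons mem_rev => /mapP[[x' y'] xy' [-> ->]]; rewrite /joins xy' orbT.
have q1c : {subset steps a (rcons p1 b) <= csteps c}.
  by move=> xy xy1; rewrite cstepsE csE mem_cat xy1.
have q2c : {subset steps b (rcons p2 a) <= csteps c}.
  by move=> xy xy2; rewrite cstepsE csE mem_cat xy2 orbT.
have sz x y : joins (steps a (rcons p b)) x y -> (x, y) \in csteps c -> False.
  move=> /orP[/nj|/nj]; rewrite /joins negb_or => /andP[]; first by move=> /negPf->.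
  by move=> _ /negPf->.
have [cd1 E1] : circular_path d (a :: p1 ++ b :: rev p) /\
    csteps (a :: p1 ++ b :: rev p) = steps a (rcons p1 b) ++ steps b (rcons (rev p) a).
  apply: circular_theta => //.
    apply: (@uniq_theta T (a :: p1) p2) => //; first by rewrite rev_uniq.
    by move=> z; rewrite mem_rev => /pc; rewrite pc'.
  (* If both paths were single edges, the chord would be an edge of [c]. *)
  rewrite size_rev lt0n addn_eq0 !size_eq0; apply/negP => /andP[/eqP p10 /eqP p0].
  apply: (sz a b); first by rewrite p0 /joins mem_head.
  by apply: q1c; rewrite p10 mem_head.
have [cd2 E2] : circular_path d (b :: p2 ++ a :: p) /\
    csteps (b :: p2 ++ a :: p) = steps b (rcons p2 a) ++ steps a (rcons p b).
  have perm z : (z \in (b :: p2) ++ a :: p1) = (z \in c).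
    by rewrite pc' -[RHS]/(z \in (a :: p1) ++ (b :: p2)) !mem_cat orbC.
  apply: circular_theta => //.
    apply: (@uniq_theta T (b :: p2) p1) => //; last by move=> z /pc; rewrite perm.
    by rewrite (uniq_catC (b :: p2) (a :: p1)).
  rewrite lt0n addn_eq0 !size_eq0; apply/negP => /andP[/eqP p20 /eqP p0].
  apply: (sz b a); first by rewrite p0 /joins mem_head orbT.
  by apply: q2c; rewrite p20 mem_head.
exists (a :: p1 ++ b :: rev p), (b :: p2 ++ a :: p); split=> //.
- apply: (join_lt _ (steps a (rcons p1 b))) => //.
    by move=> xy; rewrite E1 !mem_cat => /orP[->|->]; rewrite ?orbT.
  rewrite /joins E1 !mem_cat steps_rev_rcons !mem_rev; apply/orP; right.
  by apply/orP; right; apply/mapP; exists (a, w).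
- apply: (join_lt _ (steps b (rcons p2 a))) => //.
    by move=> xy; rewrite E2 !mem_cat => /orP[->|->]; rewrite ?orbT.
  by rewrite /joins E2 !mem_cat aw !orbT.
- move=> k ks; rewrite E1 E2 !parity_cat parity_rev //.
  have -> : parity k (csteps c) = parity k (csteps (a :: p1 ++ b :: p2)).
    by rewrite -rotE csteps_rot // parity_rot.
  rewrite csE parity_cat.
  by case: (parity _ _) (parity _ _) (parity k (steps a (rcons p b))) => [] [] [].
Qed.

(** Generation of the cycle space in dual form: a linear form that vanishes on tight cycles vanishes
    on all cycles. *)
Theorem parity_tight k : symmetric k ->
  (forall c, tight c -> parity k (csteps c) = false) ->
  forall c, circular_path d c -> parity k (csteps c) = false.
Proof.
move=> ks kt c; have [n] := ubnP #|inner_edges c|; elim: n c => // n IH c cn cd.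
have [tc|/(inner_path_exists cd)[a [p [b]]]] := pselect (tight c); first exact: kt.
case/(split_cycle cd) => c1 [c2 [cd1 cd2 lt1 lt2 ->]] //.
by rewrite !IH //; exact: leq_trans lt1 _ || exact: leq_trans lt2 _.
Qed.

End Generation.

(** * Linear forms that vanish on cycles are cuts *)

Section CycleEdges.
Context (T : finType).
Implicit Types (x y : T) (p c : seq T) (k r : rel T).

Lemma csteps_asym r c x y : circular_path r c -> (x, y) \in csteps c ->
  (y, x) \notin csteps c.
Proof.
move=> cc xy; have [n [p [rotE _ _ _]]] := csteps_rot_to cc xy.
have := circular_rot n cc; rewrite rotE => cr.
apply/negP; rewrite -(mem_rot n) -csteps_rot ?(circular_uniq cc) // rotE.
case/mapP=> _ _ [<-]; case/circular_consP: cr => _ + s.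
case: p {rotE} s => // z p _ /and3P[xN _ _]; rewrite /= eq_sym.
case: eqP => [yx|_]; first by move: xN; rewrite yx mem_head.
by rewrite eqxx => xz; move: xN; rewrite xz !inE eqxx orbT.
Qed.

(** The parity depends only on the set of undirected edges: a cycle of at least three nodes uses
    each of its edges once, by [csteps_asym]. *)
Lemma parity_joins k r r' c c' : symmetric k -> circular_path r c -> circular_path r' c' ->
  (forall x y, joins (csteps c) x y = joins (csteps c') x y) ->
  parity k (csteps c) = parity k (csteps c').
Proof.
move=> ks cc cc' jE.
pose K (E : {set T}) := [exists x, exists y, (E == [set x; y]%SET) && k x y].
have KE x y : K [set x; y]%SET = k x y.
  apply/existsP/idP=> [[u /existsP[v /andP[/eqP E kuv]]]|kxy]; last first.
    by exists x; apply/existsP; exists y; rewrite eqxx.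
  have := set21 u v; have := set22 u v; have := set21 x y; have := set22 x y.
  rewrite E -{3 4}E !inE => yuv xuv vxy uxy.
  move: kuv; case/orP: uxy vxy xuv yuv => /eqP-> /orP[]/eqP-> //; rewrite ?orbb ?eqxx ?orbT //.
  - by move=> _ /eqP->.
  - by rewrite ks.
  - by move=> /eqP->.
have edges r0 c0 : circular_path r0 c0 ->
    parity k (csteps c0) =
    \big[addb/false]_(E in [set [set x; next c0 x] | x in c0]%SET) K E.
  move=> cc0; have uc0 := circular_uniq cc0.
  rewrite /parity big_map big_uniq //= big_imset /=.
    by apply: eq_bigr => x _; rewrite KE.
  move=> x y xc yc /= E; have xy := set21 x (next c0 x); rewrite E !inE in xy.
  case/orP: xy => /eqP // xny.
  have := set22 x (next c0 x); rewrite E !inE => /orP[/eqP nxy|/eqP nxy].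
    have xs : (x, y) \in csteps c0 by rewrite -nxy; exact: map_f.
    have ys : (y, x) \in csteps c0 by rewrite xny; exact: map_f.
    by have := csteps_asym cc0 xs; rewrite ys.
  by rewrite -(prev_next uc0 x) nxy prev_next.
rewrite (edges _ _ cc) (edges _ _ cc'); apply: eq_bigl => E.
have half r0 r1 c0 c1 : circular_path r0 c0 -> circular_path r1 c1 ->
    (forall x y, joins (csteps c0) x y -> joins (csteps c1) x y) ->
    E \in [set [set x; next c0 x] | x in c0]%SET ->
    E \in [set [set x; next c1 x] | x in c1]%SET.
  move=> cc0 cc1 jj /imsetP[x xc ->].
  have : joins (csteps c0) x (next c0 x) by rewrite /joins (map_f (fun x => (x, next c0 x)) xc).
  move=> /jj /orP[] /mapP[y yc [-> ->]]; first exact: imset_f.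
  by rewrite finset.setUC; exact: imset_f.
by apply/idP/idP; [apply: half cc cc' _|apply: half cc' cc _] => x y; rewrite jE.
Qed.

Lemma repeatP p : ~~ uniq p -> exists y p1 p2 p3, p = p1 ++ y :: p2 ++ y :: p3.
Proof.
elim: p => //= z p IH; rewrite negb_and negbK => /orP[zp|/IH[y [p1 [p2 [p3 ->]]]]].
  by case/splitPr: zp => p2 p3; exists z, [::], p2, p3.
by exists y, (z :: p1), p2, p3.
Qed.

(** A repeated node cuts the walk into two shorter closed walks. Without repetition it is a cycle,
    or an edge followed back and forth, which counts twice. *)
Lemma parity_closed_walk k r x p : symmetric k -> irreflexive r ->
  (forall c, circular_path r c -> parity k (csteps c) = false) ->
  path r x p -> last x p = x -> parity k (steps x p) = false.
Proof.
move=> ks ri even; have [n] := ubnP (size p); elim: n x p => // n IH x p sp xp lx.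
have [up|/repeatP[y [p1 [p2 [p3 pE]]]]] := boolP (uniq p).
  case/lastP: p sp xp lx up => [|p z] sp; first by rewrite /parity big_nil.
  rewrite last_rcons => + zx; rewrite {}zx rcons_uniq => xp xup.
  case: p sp xp xup => [|y [|w p]] sp xp xup; first by move: xp; rewrite /= ri.
    by rewrite /= !parity_cons /parity big_nil ks addbF addbb.
  rewrite -csteps_cons //; apply: even; exact/circular_consP.
have E : steps x p = steps x (rcons p1 y) ++ steps y (rcons p2 y) ++ steps y p3.
  by rewrite pE -cat_rcons steps_cat last_rcons -cat_rcons steps_cat last_rcons.
have : path r x p by [].
rewrite {1}pE -cat_rcons cat_path last_rcons -cat_rcons cat_path last_rcons.
case/and3P=> p1P p2P p3P; have lE : last y p3 = x.
  by move: lx; rewrite pE -cat_rcons last_cat last_rcons -cat_rcons last_cat last_rcons.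
have s2 : parity k (steps y (rcons p2 y)) = false.
  by apply: IH; rewrite ?last_rcons // size_rcons; move: sp; rewrite pE !size_cat /= size_cat /=; lia.
have s1 : parity k (steps x (rcons p1 y ++ p3)) = false.
  apply: IH; last by rewrite last_cat last_rcons.
    by rewrite size_cat size_rcons; move: sp; rewrite pE !size_cat /= size_cat /=; lia.
  by rewrite cat_path last_rcons p1P.
rewrite E !parity_cat s2; move: s1; rewrite steps_cat last_rcons parity_cat.
by case: (parity _ _) (parity _ _) => [] [].
Qed.

(** The side of a node is the parity of any walk to it from a base node [x0]; two such walks differ
    by a closed walk. *)
Lemma even_cut k r (S : {set T}) : symmetric k -> symmetric r -> irreflexive r ->
  (forall x y, r x y -> x \notin S /\ y \notin S) ->
  (forall x y, x \notin S -> y \notin S -> connect r x y) ->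
  (forall c, circular_path r c -> parity k (csteps c) = false) ->
  exists X : {set T}, forall x y, r x y -> k x y = (x \in X) (+) (y \in X).
Proof.
move=> ks rs ri rS rconn even.
have [[x0 x0S]|none] := pselect (exists x0, x0 \notin S); last first.
  by exists finset.set0 => x y /rS[xS _]; case: none; exists x.
have indep p q : path r x0 p -> path r x0 q -> last x0 p = last x0 q ->
    parity k (steps x0 p) = parity k (steps x0 q).
  move=> pp pq E; case/lastP: q pq E => [|q y] pq E.
    by rewrite [in RHS]/parity big_nil; exact: parity_closed_walk pp E.
  have := @parity_closed_walk k r x0 (p ++ rcons (rev q) x0) ks ri even.
  rewrite last_cat last_rcons cat_path pp E last_rcons steps_cat parity_cat E last_rcons.
  rewrite parity_rev //; case: (parity _ _) (parity _ _) => [] [] // H.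
    by symmetry; apply: H => //; apply: path_steps => u v;
      rewrite steps_rev_rcons mem_rev => /mapP[[z w] zw [-> ->]]; rewrite rs; exact: steps_path pq zw.
  by apply: H => //; apply: path_steps => u v;
      rewrite steps_rev_rcons mem_rev => /mapP[[z w] zw [-> ->]]; rewrite rs; exact: steps_path pq zw.
exists [set y | `[< exists p, [/\ path r x0 p, last x0 p = y & parity k (steps x0 p)] >]]%SET.
have XE p : path r x0 p -> (last x0 p \in [set y | `[< exists p, [/\ path r x0 p,
    last x0 p = y & parity k (steps x0 p)] >]]%SET) = parity k (steps x0 p).
  move=> pp; rewrite inE; apply/asboolP/idP => [[q [pq E kq]]|kp]; last by exists p.
  by rewrite (indep p q).
move=> x y rxy; have [xS _] := rS _ _ rxy.
have /connectP[p pp xE] := rconn _ _ x0S xS.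
have pq : path r x0 (rcons p y) by rewrite rcons_path pp -xE.
have := XE _ pq; rewrite last_rcons => ->; rewrite {2}xE XE // steps_rcons -cats1 parity_cat.
rewrite -xE /parity big_seq1 /=; case: (\big[addb/false]_(_ <- _) _); by case: (k x y).
Qed.

End CycleEdges.

(** * From tight cycles to elementary polygons *)

Section ElementaryPolygons.
Context (R : realType) (T : finType) (e : rel T).
Hypotheses (e_sym : symmetric e) (e_irr : irreflexive e).
Variable emb : plane_embedding R e.
Hypothesis conn : four_connected e.
Variable S : {set T}.
Hypothesis S1 : (#|S| <= 1)%N.
Implicit Types (x y u v : T) (c p : seq T) (q : R * R) (k : rel T).

Notation d := (del e S).
Notation comp c := (connected_component (~` path_curve emb c)).

Lemma tight_component c c' q : tight emb S c -> tight emb S c' ->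
  surrounds emb c q -> surrounds emb c' q -> comp c q `<=` comp c' q.
Proof.
move=> [cd tc] [cd' tc'] sq sq'.
have [nq _] := sq; have [nq' _] := sq'.
apply: connected_component_max; last exact: component_connected.
  exact: connected_component_refl.
move=> z qz [x xc zx]; have sz := surrounds_component qz sq.
apply: (tc x (next c' x) z _ zx sz); apply: (circular_step cd').
exact: (map_f (fun x => (x, next c' x)) xc).
Qed.

(** Both cycles have the same region around [q]. An edge of [c] is adherent to it, so an edge
    missing from [c'] would have a point in the region itself, hence off [c]. *)
Lemma tight_joins c c' q x y : tight emb S c -> tight emb S c' ->
  surrounds emb c q -> surrounds emb c' q ->
  joins (csteps c) x y -> joins (csteps c') x y.
Proof.
move=> tc tc' sq sq' jxy; apply/negPn/negP => nj.
have cc := circular_del tc.1; have cc' := circular_del tc'.1.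
have exy := joins_csteps_edge e_sym cc jxy.
have [z oz clz] : exists2 z : R * R, open_edge emb x y z & closure (comp c q) z.
  case/orP: jxy => xy; first exact: inner_boundary xy.
  by rewrite open_edge_sym //; exact: inner_boundary xy.
have cE : comp c q = comp c' q by apply/seteqP; split; exact: tight_component.
have nz : ~ path_curve emb c' z.
  move=> c'z; have : (open_edge emb x y `&` path_curve emb c') z by [].
  by rewrite open_edge_cycle.
have : comp c q z.
  by rewrite cE; apply: component_closure; [exact: path_curve_open|rewrite -cE].
move=> /connected_component_sub; apply.
exact: (joins_path_curve e_sym cc jxy) (open_edge_curve oz).
Qed.

Lemma neighbor_exists (c : seq T) x : circular_path d c -> exists y, e x y.
Proof.
move=> cd; have cc := circular_del cd.
have [y yc yx] : exists2 y, y \in c & y != x.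
  case: c cd cc => [[]//|a [[]//|b c]] _ /circular_uniq/andP[aN _].
  have [ax|ax] := eqVneq a x; last by exists a; rewrite ?mem_head.
  exists b; first by rewrite !inE eqxx orbT.
  by rewrite -ax; apply: contraNneq aN => ->; exact: mem_head.
have := @conn finset.set0 _ x y; rewrite cards0 !inE => /(_ isT isT isT).
case/connect_exit/(_ (mem_head x [::])) => [|u [v [/and3P[euv _ _]]]].
  by rewrite inE.
by rewrite inE => /eqP <- _; exists v.
Qed.

(** A surrounded point on an edge at a node of [S] would make that node surrounded too. Nodes are
    handled through edges, since each has a neighbor. *)
Lemma tight_elementary c : tight emb S c ->
  (forall b, b \in S -> ~ surrounds emb c (node_pt emb b)) -> elementary_polygon emb c.
Proof.
move=> [cd tc] nS; have cc := circular_del cd.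
have cS z : z \in c -> z \notin S.
  by move=> zc; have /(circular_step cd)/and3P[] := map_f (fun x => (x, next c x)) zc.
have edge x y q : e x y -> edge_curve emb x y q -> ~ surrounds emb c q.
  move=> exy qxy sq; have [nq _] := sq.
  have aux u v : e u v -> edge_curve emb u v q -> u \in S -> False.
    move=> euv; rewrite edge_curveE // => + uS.
    have uc : u \notin c by apply: contraL uS; exact: cS.
    case=> [oq|[qE|qE]].
    - by apply: (nS u) => //; apply/(half_edge e_irr cc euv uc oq).
    - by apply: (nS u) => //; rewrite -qE.
    - rewrite {}qE in sq nq *; apply: (nS u) => //.
      have evu : e v u by rewrite e_sym.
      apply: (surrounds_neighbor e_sym e_irr cc evu) => //.
      by apply/negP => vc; apply: nq; exact: path_curve_node.
  have [xS|xS] := boolP (x \in S); first exact: aux exy qxy xS.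
  have [yS|yS] := boolP (y \in S).
    by apply: (aux y x); rewrite // ?(edge_curve_sym e_sym emb exy) // e_sym.
  by apply: (tc x y q) => //; rewrite /del /= exy xS.
split; last by move=> x y q; exact: edge.
split=> // z; have [w ezw] := neighbor_exists z cd.
by apply: (edge _ _ _ ezw); rewrite edge_curveE //; right; left.
Qed.

Lemma del_connected x y : x \notin S -> y \notin S -> connect d x y.
Proof. by move=> xS yS; apply: conn => //; exact: leq_ltn_trans S1 _. Qed.

Lemma cut_of_tight k : symmetric k ->
  (forall c, tight emb S c -> parity k (csteps c) = false) ->
  exists X : {set T}, forall x y, d x y -> k x y = (x \in X) (+) (y \in X).
Proof.
move=> ks kt; apply: (@even_cut _ _ d S ks).
- exact: del_sym.
- by move=> x; rewrite /del /= e_irr.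
- by move=> x y /and3P[_ xS yS].
- exact: del_connected.
- exact: (parity_tight e_sym e_irr conn S1 ks kt).
Qed.

(* When the node of [S] lies inside the outer face of the rest of the graph, [phi]
   is unused; otherwise it bounds the face of [e] minus [S] that contains it. *)
Theorem cut_of_elementary : exists phi : seq T, forall k, symmetric k ->
  (forall c, elementary_polygon emb c -> (forall b, b \in S -> b \notin c) ->
     parity k (csteps c) = false) ->
  parity k (csteps phi) = false ->
  exists X : {set T}, forall x y, d x y -> k x y = (x \in X) (+) (y \in X).
Proof.
have elem c : tight emb S c -> (forall b, b \in S -> ~ surrounds emb c (node_pt emb b)) ->
    elementary_polygon emb c /\ (forall b, b \in S -> b \notin c).
  move=> tc nS; split; first exact: tight_elementary.
  move=> b bS; apply: contraL bS => bc; have [cd _] := tc.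
  by have /(circular_step cd)/and3P[] := map_f (fun x => (x, next c x)) bc.
have [[phi [b [tphi bS sb]]]|none] := pselect (exists phi b,
    [/\ tight emb S phi, b \in S & surrounds emb phi (node_pt emb b)]).
  exists phi => k ks kel kphi; apply: cut_of_tight => // c tc.
  have [sc|nsc] := pselect (surrounds emb c (node_pt emb b)); last first.
    have [||ec bc] := elem c => //; last exact: kel.
    by move=> b' b'S; have -> : b' = b by apply: (card_le1_eqP S1).
  (* All tight cycles around [b] have the same edges as [phi]. *)
  rewrite -kphi; apply: (parity_joins ks tc.1 tphi.1) => x y.
  by apply/idP/idP; [exact: tight_joins tc tphi sc sb|exact: tight_joins tphi tc sb sc].
exists [::] => k ks kel _; apply: cut_of_tight => // c tc.
have [||ec bc] := elem c => //; last exact: kel.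
by move=> b bS sb; apply: none; exists c, b.
Qed.

End ElementaryPolygons.

Theorem cut_of_elementary0 (R : realType) (T : finType) (e : rel T)
    (emb : plane_embedding R e) (k : rel T) :
  symmetric e -> irreflexive e -> four_connected e -> symmetric k ->
  (forall c, elementary_polygon emb c -> parity k (csteps c) = false) ->
  exists X : {set T}, forall x y, e x y -> k x y = (x \in X) (+) (y \in X).
Proof.
move=> es ei conn ks kel; have S0 : (#|@finset.set0 T| <= 1)%N by rewrite cards0.
have [|X XP] := @cut_of_tight R T e es ei emb conn _ S0 k ks.
  by move=> c tc; apply: kel; apply: tight_elementary tc _ => // b; rewrite inE.
by exists X => x y exy; apply: XP; rewrite /del /= exy !inE.
Qed.

(** * The nodes that never deliver *)

Section Walks.
Context (T : finType) (e : rel T).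
Hypothesis e_sym : symmetric e.
Implicit Types (x y : T) (p c : seq T).

(** [find] returns the first admissible length; as it never exceeds [#|T|], any shorter walk would
    have been met in the list searched. *)
Lemma dist_le x p : (dist e x (last x p) <= size p)%N || ~~ path e x p.
Proof.
have [pp|] := boolP (path e x p); last by rewrite orbT.
rewrite orbF leqNgt; apply/negP; rewrite /dist => lt.
have sT : (size p < #|T|)%N.
  by apply: leq_trans lt _; rewrite -[leqRHS](size_iota 0) find_size.
have := before_find 0%N lt; rewrite nth_iota // add0n /= => /negbT/negP; apply.
by apply/existsP; exists (in_tuple p); rewrite pp eqxx.
Qed.

Lemma path_reverse x p : path e x p ->
  exists q, [/\ path e (last x p) q, last (last x p) q = x & size q = size p].
Proof.
move=> xp; exists (rev (belast x p)); split.
- by rewrite rev_path; apply: sub_path xp => y z; rewrite e_sym.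
- by case: p xp => //= y p _; rewrite rev_cons last_rcons.
- by rewrite size_rev size_belast.
Qed.

(** The shorter of the two arcs has at most half of the edges. *)
Lemma cycle_walk c x y : circular_path e c -> x \in c -> y \in c ->
  exists p, [/\ path e x p, last x p = y & (2 * size p <= size c)%N].
Proof.
move=> cc xc yc; have [->|xy] := eqVneq x y; first by exists [::].
have [n [p1 [p2 rotE]]] : exists n (p1 p2 : seq T), rot n c = x :: p1 ++ y :: p2.
  have [n p1 p2 _ _ rotE] := rot_to_arc (circular_uniq cc) xc yc xy.
  by exists n, p1, p2.
have := circular_rot n cc; rewrite rotE => /circular_consP[+ _ _].
rewrite rcons_theta cat_path last_rcons => /andP[d1 d2].
have sE : size c = (size p1 + size p2).+2.
  by rewrite -(size_rot n) rotE /= size_cat /= addnS.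
have [le12|lt21] := leqP (size p1) (size p2).
  by exists (rcons p1 y); rewrite last_rcons size_rcons sE; split=> //; lia.
have [q [+ + sq]] := path_reverse d2; rewrite last_rcons => qp qx.
by exists q; split=> //; rewrite sq sE size_rcons; lia.
Qed.

Lemma connect_const (r : rel T) (f : T -> bool) x y :
  (forall u v, connect r x u -> r u v -> f u = f v) -> connect r x y -> f x = f y.
Proof.
move=> rf /connectP[p]; elim/last_ind: p y => [|p z IH] y; first by move=> _ ->.
rewrite rcons_path last_rcons => /andP[xp lz] ->; rewrite (IH _ xp erefl).
by apply: rf lz; apply/connectP; exists p.
Qed.

Lemma parity_coboundary (r : rel T) (f : T -> bool) c : circular_path r c ->
  parity (fun x y => f x (+) f y) (csteps c) = false.
Proof.
case: c => [[]//|x p cc]; rewrite csteps_cons ?(circular_uniq cc) //.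
have walk q z : parity (fun x y => f x (+) f y) (steps z q) = f z (+) f (last z q).
  elim: q z => [|w q IH] z; first by rewrite /parity big_nil addbb.
  rewrite /= parity_cons IH; by case: (f z) (f w) (f (last w q)) => [] [] [].
by rewrite walk last_rcons addbb.
Qed.

Lemma first_outside (C : {pred T}) p y : y \notin C -> exists p1 z p2,
  [/\ rcons p y = p1 ++ z :: p2, {subset p1 <= C} & z \notin C].
Proof.
move=> yC; elim: p => [|x p [p1 [z [p2 [pE p1C zC]]]]]; first by exists [::], y, [::].
have [xC|xC] := boolP (x \in C); last by exists [::], x, (rcons p y).
exists (x :: p1), z, p2; rewrite rcons_cons pE; split=> // w; rewrite inE.
by case/orP=> [/eqP->|/p1C].
Qed.

Lemma cycle_exit (r : rel T) c (X : {pred T}) x y : circular_path r c ->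
  x \in c -> y \in c -> x \in X -> y \notin X ->
  exists u v, [/\ (u, v) \in csteps c, u \in X & v \notin X].
Proof.
move=> cc xc yc xX yX; have uc := circular_uniq cc.
have [n p rotE] := rot_to xc.
have xp : path [rel u v | (u, v) \in csteps c] x (rcons p x).
  apply: path_steps => u v /=; rewrite -csteps_cons -rotE ?rot_uniq // csteps_rot //.
  by rewrite mem_rot.
have yp : y \in x :: rcons p x.
  by rewrite -rcons_cons -rotE mem_rcons inE mem_rot yc orbT.
exact: connect_exit (path_connect xp yp) xX yX.
Qed.

End Walks.

Local Open Scope nat_scope.

Local Notation "[ 'set' x | P ]" := [set x | P]%SET.

Lemma half_add_half (a b f g z : nat) :
  2 * a <= f -> 2 * b <= g -> f <= z -> g <= z -> a + b <= z.
Proof. lia. Qed.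

Lemma half_succ (a f : nat) : 2 < f -> 2 * a <= f -> a < f.
Proof. lia. Qed.

(** * The spread of delivery, as a statement about graphs alone *)

Section Spread.
Context (R : realType) (T : finType) (e : rel T).
Hypotheses (e_sym : symmetric e) (e_irr : irreflexive e).
Variable emb : plane_embedding R e.
Hypothesis conn : four_connected e.
Variable Z : nat.
Hypothesis Z_gt2 : 2 < Z.
Hypothesis Z_max : forall c, elementary_polygon emb c -> size c <= Z.
Variables (B W : {set T}) (src u0 : T).
Hypothesis D_gt : forall b b', b \in B -> b' \in B -> b != b' -> Z < dist e b b'.
Hypothesis srcW : src \in W.
Hypothesis src_nb : forall y, e src y -> y \in W :|: B.
Hypothesis no_link : forall q p u, p != [::] -> size p <= Z - 2 ->
  path e q (rcons p u) -> uniq (q :: rcons p u) -> q \in W -> u \in W ->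
  ~ {subset p <= ~: (W :|: B)}.
Hypothesis u0N : u0 \notin W :|: B.
Implicit Types (x y : T) (p F : seq T) (M : {set T}).

Notation elementary := (elementary_polygon emb).

(** [C] may contain Byzantine nodes; [D] may contain Byzantine nodes as well as nodes of other
    components outside [W]. *)
Let r : rel T := [rel u v | [&& e u v, u \notin W & v \notin W]].
Let C : {set T} := [set x | connect r u0 x].
Let D : {set T} := [set x | connect (del e C) src x].

Lemma elementary_circular F : elementary F -> circular_path e F.
Proof. by case=> [[]]. Qed.

Lemma walk_byz b b' p : b \in B -> b' \in B -> path e b p -> last b p = b' ->
  size p <= Z -> b = b'.
Proof.
move=> bB b'B bp bE sp; have [//|/(D_gt bB b'B) lt] := eqVneq b b'.
by have := dist_le e b p; rewrite bp orbF bE => le; move: (leq_trans lt (leq_trans le sp)); rewrite ltnn.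
Qed.

(** Going from [b] to [n] and then to [b'] along the shorter arcs takes at most half of [Z] twice,
    so the distance hypothesis forces equality. *)
Lemma shared_byz F F' n b b' : elementary F -> elementary F' -> n \in F -> n \in F' ->
  b \in B -> b' \in B -> b \in F -> b' \in F' -> b = b'.
Proof.
move=> eF eF' nF nF' bB b'B bF b'F'.
have [p [bp pn sp]] := cycle_walk e_sym (elementary_circular eF) bF nF.
have [q [nq qb sq]] := cycle_walk e_sym (elementary_circular eF') nF' b'F'.
apply: (walk_byz bB b'B (p := p ++ q)); first by rewrite cat_path bp pn.
  by rewrite last_cat pn.
rewrite size_cat; exact: half_add_half sp sq (Z_max eF) (Z_max eF').
Qed.

Lemma C_W x : x \in C -> x \notin W.
Proof.
rewrite inE => /connectP[p]; case/lastP: p => [|p y].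
  by move=> _ ->; move: u0N; rewrite inE negb_or => /andP[].
by rewrite rcons_path last_rcons => /andP[_ /and3P[_ _ yW]] ->.
Qed.

Lemma u0C : u0 \in C.
Proof. by rewrite inE connect0. Qed.

Lemma C_adj x y : x \in C -> e x y -> y \notin C -> y \in W.
Proof.
move=> xC exy; apply: contraR => yW; have xW := C_W xC; rewrite !inE in xC *.
by apply: (connect_trans xC); apply: connect1; rewrite /r /= exy xW.
Qed.

Lemma srcC : src \notin C.
Proof. by apply/negP => /C_W; rewrite srcW. Qed.

Lemma D_C x : x \in D -> x \notin C.
Proof.
rewrite inE => /connectP[p]; case/lastP: p => [|p y]; first by move=> _ ->; exact: srcC.
by rewrite rcons_path last_rcons => /andP[_ /and3P[_ _ yC]] ->.
Qed.

Lemma srcD : src \in D.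
Proof. by rewrite inE connect0. Qed.

Lemma D_adj x y : x \in D -> e x y -> y \notin D -> y \in C.
Proof.
move=> xD exy; apply: contraR => yC; have xC := D_C xD; rewrite [_ \in D]inE in xD.
by rewrite inE; apply: (connect_trans xD); apply: connect1; rewrite /del /= exy xC.
Qed.

(** Following [F] from a node outside [C] into [C] and up to the next node outside gives a short
    path with both ends in [W]. By [no_link] it has a Byzantine inner node. *)
Lemma byz_of_polygon F x y z : elementary F -> x \in F -> y \in F -> x \notin C -> y \notin C ->
  x != y -> z \in F -> z \in C -> exists b, [/\ b \in F, b \in B & b \in C].
Proof.
move=> eF xF yF xC yC xy zF zC; have cF := elementary_circular eF.
have [n [c [nc nC cC]]] : exists n c, [/\ (n, c) \in csteps F, n \notin C & c \in C].
  have := cycle_exit cF xF zF (X := ~: C); rewrite !finset.in_setC zC => /(_ xC isT).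
  by case=> n [c []]; rewrite !finset.in_setC negbK; exists n, c.
have [k [p [rotE cp cu csE]]] := csteps_rot_to cF nc.
have enc := circular_step cF nc.
have nW : n \in W by apply: (C_adj cC) => //; rewrite e_sym.
have [s1 [w [s2 [sE s1C wC]]]] := @first_outside T (mem C) (c :: p) n nC.
rewrite rcons_cons in sE.
have s10 : s1 != [::] by case: (s1) sE => // -[cw _]; rewrite -cw cC in wC.
have uF : uniq (n :: c :: p) by rewrite -rotE rot_uniq (circular_uniq cF).
have memF v : v \in F = (v \in n :: c :: p) by rewrite -rotE mem_rot.
have np : path e n (rcons s1 w).
  have : path e n (s1 ++ w :: s2) by rewrite -sE /= enc.
  by rewrite -cat_rcons cat_path => /andP[].
have wW : w \in W.
  move: np; rewrite rcons_path => /andP[_ lw]; apply: (C_adj _ lw wC).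
  case/lastP: (s1) s10 s1C => // s v _ s1C; rewrite last_rcons.
  by apply: s1C; rewrite mem_rcons mem_head.
have lastE : last w s2 = n.
  by rewrite -[LHS]/(last (last n s1) (w :: s2)) -last_cat -sE -rcons_cons last_rcons.
(* Otherwise [n] would be the only node of [F] outside [C], whereas [x] and [y] are two. *)
have wn : w != n.
  apply/eqP => wn; have : uniq (c :: rcons p n) by [].
  rewrite sE cat_uniq => /and3P[_ _]; rewrite wn => /andP[nNs2 _].
  case/lastP: s2 lastE sE nNs2 => [|s2 v] + sE; last by rewrite last_rcons => vn nN; rewrite vn mem_rcons mem_head in nN.
  move=> _ _; have s1E : s1 = c :: p.
    by apply/esym/eqP; move/eqP: sE; rewrite wn -rcons_cons cats1 eqseq_rcons => /andP[].
  have only v : v \in F -> v \notin C -> v = n.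
    by rewrite memF inE -s1E => /orP[/eqP//|/s1C vC]; rewrite [v \in C]vC.
  by move: xy; rewrite (only x) // (only y) // eqxx.
have us : uniq (n :: rcons s1 w).
  have : uniq (c :: rcons p n) by [].
  rewrite sE -cat_rcons cat_uniq => /and3P[us1 _ _].
  rewrite /= us1 andbT mem_rcons inE negb_or eq_sym wn /=.
  by apply/negP => /s1C nC'; rewrite [n \in C]nC' in nC.
(* Besides [s1], the polygon contains [w] and [n]; the latter is the end of [s2]. *)
have ss : size s1 <= Z - 2.
  have s2n : s2 != [::] by apply: contraNneq wn => s20; move: lastE; rewrite s20 /= => ->.
  rewrite (leq_subRL _ (ltnW Z_gt2)) addnC; apply: leq_trans (Z_max eF).
  rewrite -(size_rot k F) rotE /= -(size_rcons p n).
  have -> : (size (rcons p n)).+1 = size s1 + (size s2).+1 by rewrite -[LHS]/(size (c :: rcons p n)) sE size_cat.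
  by rewrite leq_add2l ltnS lt0n size_eq0.
have : ~~ all (mem (~: (W :|: B))) s1.
  by apply/negP => /allP; exact: no_link ss np us nW wW.
case/allPn => b bs; rewrite !inE negbK (negPf (C_W (s1C _ bs))) /= => bB.
exists b; split=> //; last exact: s1C.
have : b \in c :: rcons p n by rewrite sE mem_cat bs.
by rewrite memF -rcons_cons mem_rcons.
Qed.

Let cut (M : {set T}) : rel T :=
  [rel x y | (x \in M) && (y \in C) || (y \in M) && (x \in C)].

Lemma cut_sym M : symmetric (cut M).
Proof. by move=> x y; rewrite /cut /= orbC. Qed.

Lemma cut_out M x y : x \notin C -> y \notin C -> cut M x y = false.
Proof. by rewrite /cut /= => /negPf-> /negPf->; rewrite !andbF. Qed.

Lemma cut_in M x y : M \subset D -> x \in C -> y \in C -> cut M x y = false.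
Proof.
move=> /fintype.subsetP MD xC yC; rewrite /cut /= xC yC !andbT.
by apply/norP; split; apply/negP => /MD/D_C/negP; apply.
Qed.

Lemma cut_edge M n y : n \in M -> y \in C -> cut M n y.
Proof. by rewrite /cut /= => -> ->. Qed.

(** If no relevant node of [D] is in [M], the cut misses [F]. If all are, it agrees on [F] with the
    coboundary of [D], because an edge that leaves [D] ends in [C]. *)
Lemma parity_cut M F : elementary F -> M \subset D ->
  (forall n y, n \in F -> y \in F -> n \in D -> y \in C -> n \in M) \/
  (forall n y, n \in F -> y \in F -> n \in D -> y \in C -> n \notin M) ->
  parity (cut M) (csteps F) = false.
Proof.
move=> eF /fintype.subsetP MD all_or_none; have cF := elementary_circular eF.
case: all_or_none => [inM|notM]; last first.
  rewrite /parity big_seq big1 // => -[x y] /mem_csteps/andP[xF yF] /=.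
  rewrite /cut /=; apply/norP; split; apply/negP => /andP[nM nC].
    by move: (notM x y xF yF (MD _ nM) nC); rewrite nM.
  by move: (notM y x yF xF (MD _ nM) nC); rewrite nM.
rewrite -(parity_coboundary (fun x => x \in D) cF) /parity big_seq [in RHS]big_seq.
apply: eq_bigr => -[x y] xy /=; have exy := circular_step cF xy.
have /andP[xF yF] := mem_csteps xy; rewrite /cut /=.
have [xD|xD] := boolP (x \in D); have [yD|yD] := boolP (y \in D).
- by rewrite (negPf (D_C xD)) (negPf (D_C yD)) !andbF.
- by have yC := D_adj xD exy yD; rewrite (inM x y) // yC.
- have xC : x \in C by apply: (D_adj yD) => //; rewrite e_sym.
  by rewrite (inM y x) // xC orbT.
- have -> : x \in M = false by apply/negP => /MD; rewrite (negPf xD).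
  by have -> : y \in M = false by apply/negP => /MD; rewrite (negPf yD).
Qed.

Let transition F : Prop := elementary F /\ exists n n' y,
  [/\ n \in F, n' \in F, y \in F & [/\ n \in D, n' \in D, n != n' & y \in C]].

Lemma transition_byz F : transition F -> exists b, [/\ b \in F, b \in B & b \in C].
Proof.
move=> [eF [n [n' [y [nF n'F yF [nD n'D nn' yC]]]]]].
exact: byz_of_polygon eF nF n'F (D_C nD) (D_C n'D) nn' yF yC.
Qed.

(** Without two distinct nodes of [D] on [F], the alternative of [parity_cut] holds for any [M]. *)
Lemma parity_cut_stable M F : elementary F -> M \subset D -> ~ transition F ->
  parity (cut M) (csteps F) = false.
Proof.
move=> eF MD nt; apply: parity_cut => //.
have same n n' y : n \in F -> n' \in F -> y \in F -> n \in D -> n' \in D -> y \in C -> n = n'.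
  move=> nF n'F yF nD n'D yC; have [//|nn'] := eqVneq n n'.
  by case: nt; split=> //; exists n, n', y.
have [[n [y [nF yF nD yC nM]]]|none] :=
    pselect (exists n y, [/\ n \in F, y \in F, n \in D, y \in C & n \in M]); last first.
  by right=> n y nF yF nD yC; apply/negP => nM; apply: none; exists n, y.
by left=> n' y' n'F _ n'D _; rewrite -(same n n' y).
Qed.

(** One Byzantine node [b] lies on all transition polygons: the nodes of [D] that share such a
    polygon with [b] define a cut, and connectedness of [C] and [D] makes it contain every edge
    between [D] and [C]. *)
Lemma transition_cover : exists S : {set T}, [/\ #|S| <= 1, S \subset (B :&: C)%SET,
  forall F, transition F -> exists2 b, b \in S & b \in F &
  forall y, y \in C -> e src y -> y \in S].
Proof.
have srcCB y : y \in C -> e src y -> y \in B.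
  by move=> /C_W yW /src_nb; rewrite finset.in_setU (negPf yW).
(* Without transition polygons, [S] consists of the neighbors of the source in [C]: they are
   Byzantine and two hops apart, so there is at most one. *)
have [[F0 tF0]|none] := pselect (exists F, transition F); last first.
  pose A := [set y | e src y]; have AE y : (y \in A) = e src y by rewrite finset.in_set.
  exists (A :&: C)%SET; split.
  - apply/card_le1_eqP => y y'; rewrite !finset.in_setI !AE => /andP[sy yC] /andP[sy' y'C].
    suff : y = y' by [].
    apply: (walk_byz (srcCB y yC sy) (srcCB y' y'C sy') (p := [:: src; y'])) => //.
      by rewrite /= e_sym sy sy'.
    exact: ltnW.
  - apply/fintype.subsetP => y; rewrite !finset.in_setI AE => /andP[sy yC].
    by rewrite srcCB.
  - by move=> F tF; case: none; exists F.
  - by move=> y yC sy; rewrite finset.in_setI AE sy.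
have [b [bF0 bB bC]] := transition_byz tF0.
pose M := [set n | (n \in D) && `[< exists2 F, transition F & n \in F /\ b \in F >]].
have MP n : n \in M -> exists F, [/\ transition F, n \in F & b \in F].
  by rewrite finset.in_set => /andP[_ /asboolP[F tF [nF bF]]]; exists F.
have MI n F : n \in D -> transition F -> n \in F -> b \in F -> n \in M.
  by move=> nD tF nF bF; rewrite finset.in_set nD; apply/asboolP; exists F.
have MD : M \subset D.
  by apply/fintype.subsetP => n; rewrite finset.in_set => /andP[].
have [X XP] : exists X : {set T}, forall x y, e x y -> cut M x y = (x \in X) (+) (y \in X).
  apply: (cut_of_elementary0 e_sym e_irr conn (cut_sym M)) => F eF.
  have [tF|] := pselect (transition F); last by move=> nt; have := parity_cut_stable eF MD nt.
  suff split : (forall n y, n \in F -> y \in F -> n \in D -> y \in C -> n \in M) \/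
      (forall n y, n \in F -> y \in F -> n \in D -> y \in C -> n \notin M).
    by have := parity_cut eF MD split.
  (* If [F] has the Byzantine node [b], its nodes of [D] are all in [M]; if it has another one, none
     is, by [shared_byz]. *)
  have [b' [b'F b'B b'C]] := transition_byz tF.
  have [bb'|bb'] := eqVneq b b'; [left|right] => n y nF yF nD yC.
    by apply: MI tF nF _; rewrite // bb'.
  apply/negP => /MP[F' [[eF' _] nF' bF']]; case/eqP: bb'.
  exact: shared_byz eF' eF nF' nF bB b'B bF' b'F.
have XC y : y \in C -> (u0 \in X) = (y \in X).
  rewrite [_ \in C]finset.in_set; apply: (@connect_const _ r (fun y => y \in X)) => u v u0u ruv.
  have /and3P[euv _ _] := ruv; have := XP u v euv; rewrite cut_in //.
  - by case: (u \in X) (v \in X) => [] [].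
  - by rewrite finset.in_set.
  - by rewrite finset.in_set; exact: connect_trans u0u (connect1 ruv).
have XD y : y \in D -> (src \in X) = (y \in X).
  rewrite [_ \in D]finset.in_set; apply: (@connect_const _ (del e C) (fun y => y \in X)).
  move=> u v _ /and3P[euv uC vC]; have := XP u v euv; rewrite cut_out //.
  by case: (u \in X) (v \in X) => [] [].
have cut_end F : transition F -> exists n y, [/\ n \in F, n \in D, y \in C & e n y].
  move=> [eF [n [_ [y [nF _ yF [nD _ _ yC]]]]]]; have cF := elementary_circular eF.
  have yD : y \notin D by apply: contraL yC; exact: D_C.
  have [u [v [uv uD vD]]] := cycle_exit cF nF yF nD yD.
  have euv := circular_step cF uv; exists u, v; split=> //; last exact: (D_adj uD euv vD).
  by case/mem_csteps/andP: uv.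
have XCD : (src \in X) != (u0 \in X).
  have [n [y [nF0 nD yC eny]]] := cut_end _ tF0.
  have nM := MI n F0 nD tF0 nF0 bF0.
  have := XP n y eny; rewrite (cut_edge nM yC) -(XC _ yC) -(XD _ nD).
  by case: (_ \in X) (_ \in X) => [] [].
(* [X] separates [D] from [C], so every edge between them is in the cut and its end in [D] is in
   [M]. *)
have Mall n y : n \in D -> y \in C -> e n y -> n \in M.
  move=> nD yC eny; have := XP n y eny; rewrite -(XC _ yC) -(XD _ nD).
  have -> : (src \in X) (+) (u0 \in X) by move: XCD; case: (_ \in X) (_ \in X) => [] [].
  by rewrite /cut /= => /orP[/andP[]//|/andP[_ nC]]; move: (D_C nD); rewrite nC.
exists [set b]%SET; split; first by rewrite finset.cards1.
- by rewrite finset.sub1set finset.in_setI bB.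
- move=> F tF; exists b; first exact: finset.set11.
  have [n [y [nF nD yC eny]]] := cut_end _ tF; have [b' [b'F b'B _]] := transition_byz tF.
  have [F' [[eF' _] nF' bF']] := MP _ (Mall _ _ nD yC eny).
  by rewrite (shared_byz eF' tF.1 nF' nF bB b'B bF' b'F).
- move=> y yC sy; have [F [[eF _] sF bF]] := MP _ (Mall _ _ srcD yC sy).
  have [p [sp pb szp]] := cycle_walk e_sym (elementary_circular eF) sF bF.
  rewrite finset.in_set1; apply/eqP; apply: (walk_byz (p := src :: p)) => //.
  + exact: srcCB.
  + by rewrite /= e_sym sy sp.
  (* From [y] to the source and then to [b] is one edge plus at most half of a polygon, which is
     less than [size F]. *)
  + have [_ sF2] := elementary_circular eF; apply: leq_trans (Z_max eF).
    exact: half_succ sF2 szp.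
Qed.

Let N1 (S : {set T}) : {set T} := [set n | (n \in D) && [exists y, [&& y \in C, y \notin S & e n y]]].

Lemma N1P (S : {set T}) n : reflect (n \in D /\ exists y, [/\ y \in C, y \notin S & e n y]) (n \in N1 S).
Proof.
rewrite [n \in N1 S]finset.in_set; apply: (iffP andP) => [[nD /existsP[y /and3P[yC yS eny]]]|[nD [y [yC yS eny]]]].
  by split=> //; exists y.
by split=> //; apply/existsP; exists y; apply/and3P.
Qed.

(** At most three nodes are deleted, so some walk still joins the source to [u0]; where it leaves
    [D], it provides the node. *)
Lemma N1_avoid (S A : {set T}) : #|S| <= 1 -> S \subset C -> u0 \notin S -> A \subset D ->
  #|A| <= 2 -> src \notin A -> exists2 n, n \in N1 S & n \notin A.
Proof.
move=> S1 SC u0S AD A2 sA.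
have SA : #|S :|: A| < 4.
  by apply: leq_ltn_trans (leq_card_setU _ _) _; rewrite (leq_ltn_trans (leq_add S1 A2)).
have sSA : src \notin S :|: A.
  rewrite finset.in_setU negb_or sA andbT.
  by apply: contra srcC; exact: (fintype.subsetP SC).
have uSA : u0 \notin S :|: A.
  rewrite finset.in_setU negb_or u0S; apply/negP => /(fintype.subsetP AD)/D_C.
  by rewrite u0C.
have := connect_exit (conn SA sSA uSA) srcD (_ : u0 \notin D); case.
  by apply: contraL u0C; exact: D_C.
move=> n [y [/and3P[eny nSA ySA] nD yD]]; exists n; last first.
  by move: nSA; rewrite finset.in_setU negb_or => /andP[].
apply/N1P; split=> //; exists y; split=> //; first exact: (D_adj nD eny yD).
by move: ySA; rewrite finset.in_setU negb_or => /andP[].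
Qed.

(** Off [S] and [A] the graph is connected and uncut, so it lies on one side. Each node of [A] has
    an edge to [C] outside [S], hence lies on the other side; yet an edge inside [D] enters [A]
    without being in the cut. *)
Lemma cut_not_coboundary (S A : {set T}) n0 : #|S| <= 1 -> S \subset C -> u0 \notin S ->
  A \subset N1 S -> #|A| <= 2 -> src \notin A -> n0 \in A ->
  ~ exists X : {set T}, forall x y, del e S x y -> cut A x y = (x \in X) (+) (y \in X).
Proof.
move=> S1 SC u0S AN A2 sA n0A [X XP].
have AD : A \subset D by apply/fintype.subsetP => n /(fintype.subsetP AN)/N1P[].
have D_S n : n \in D -> n \notin S.
  by move=> /D_C; apply: contra; exact: (fintype.subsetP SC).
have SA : #|S :|: A| < 4.
  by apply: leq_ltn_trans (leq_card_setU _ _) _; rewrite (leq_ltn_trans (leq_add S1 A2)).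
have sSA : src \notin S :|: A by rewrite finset.in_setU negb_or sA andbT D_S // srcD.
have XE y : y \notin S -> y \notin A -> (src \in X) = (y \in X).
  move=> yS yA; have ySA : y \notin S :|: A by rewrite finset.in_setU negb_or yS.
  apply: (connect_const (f := fun y => y \in X)) (conn SA sSA ySA) => u v _ /and3P[euv].
  rewrite !finset.in_setU !negb_or => /andP[uS uA] /andP[vS vA].
  have := XP u v; rewrite /del /= euv uS vS /cut /= (negPf uA) (negPf vA) => /(_ isT).
  by case: (u \in X) (v \in X) => [] [].
have AX n : n \in A -> (n \in X) = ~~ (src \in X).
  move=> nA; have /N1P[nD [y [yC yS eny]]] := fintype.subsetP AN _ nA.
  have yA : y \notin A by apply: contraL yC => /(fintype.subsetP AD)/D_C.
  have := XP n y; rewrite /del /= eny yS D_S // => /(_ isT); rewrite cut_edge // -(XE y) //.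
  by case: (_ \in X) (_ \in X) => [] [].
have n0D := fintype.subsetP AD _ n0A; rewrite [_ \in D]finset.in_set in n0D.
have := connect_exit n0D (X := ~: A); rewrite !finset.in_setC n0A => /(_ sA isT).
move=> [u [v [/and3P[euv uC vC]]]]; rewrite !finset.in_setC negbK => uA vA.
have uS : u \notin S by apply: contra uC; exact: (fintype.subsetP SC).
have vS : v \notin S by apply: contra vC; exact: (fintype.subsetP SC).
have := XP u v; rewrite /del /= euv uS vS => /(_ isT); rewrite cut_out // (AX v) // -(XE u) //.
by case: (src \in X).
Qed.

(** With [n1] and [n2] two distinct nodes of [N1 S], the cuts of both singletons and of the pair
    would all be odd on [phi], although the last one is the sum of the first two. *)
Theorem spread_contradiction : False.
Proof.
have [S [S1 SBC tS srcS]] := transition_cover.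
have SC : S \subset C by apply: fintype.subset_trans SBC _; exact: finset.subsetIr.
have u0S : u0 \notin S.
  apply/negP => /(fintype.subsetP SBC); rewrite finset.in_setI => /andP[u0B _].
  by move: u0N; rewrite finset.in_setU u0B orbT.
have sN1 : src \notin N1 S.
  by apply/negP => /N1P[_ [y [yC yS sy]]]; rewrite srcS in yS.
have [phi phiP] := cut_of_elementary e_sym e_irr emb conn S1.
have odd (A : {set T}) n : A \subset N1 S -> #|A| <= 2 -> n \in A ->
    parity (cut A) (csteps phi) = true.
  move=> AN A2 nA; apply/negP => /negP/negbTE even.
  have sA : src \notin A by apply: contra sN1; exact: (fintype.subsetP AN).
  apply: (cut_not_coboundary S1 SC u0S AN A2 sA nA).
  apply: phiP even; first exact: cut_sym.
  move=> F eF FS; have AD : A \subset D.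
    by apply/fintype.subsetP => m /(fintype.subsetP AN)/N1P[].
  have nt : ~ transition F by move=> /tS[b bS bF]; move: (FS b bS); rewrite bF.
  by have := parity_cut_stable eF AD nt.
have [n1 n1N _] : exists2 n, n \in N1 S & n \notin finset.set0.
  by apply: N1_avoid; rewrite ?cards0 ?finset.in_set0 ?finset.sub0set.
have n1D : n1 \in D by have /N1P[] := n1N.
have [n2 n2N] : exists2 n, n \in N1 S & n \notin [set n1]%SET.
  apply: N1_avoid; rewrite ?finset.cards1 ?finset.sub1set ?finset.in_set1 //.
  by apply: contraNneq sN1 => ->.
rewrite finset.in_set1 => n21; have n2D : n2 \in D by have /N1P[] := n2N.
have o1 := odd [set n1]%SET n1; have o2 := odd [set n2]%SET n2.
have o12 := odd [set n1; n2]%SET n1.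
have sumE : parity (cut [set n1; n2]%SET) (csteps phi) =
    parity (cut [set n1]%SET) (csteps phi) (+) parity (cut [set n2]%SET) (csteps phi).
  rewrite /parity -big_split; apply: eq_bigr => -[x y] _.
  rewrite /cut /= !finset.in_set2 !finset.in_set1.
  have n12 : (n1 == n2) = false by rewrite eq_sym (negPf n21).
  have n1C := negPf (D_C n1D).
  have [->|xn1] := eqVneq x n1; first by rewrite n12 n1C !andbF !orbF !andTb !andFb addbF.
  have [->|yn1] := eqVneq y n1; first by rewrite n12 n1C !andbF !orFb !andTb !andFb addbF.
  by [].
move: sumE; rewrite o1 ?o2 ?o12 // ?finset.cards1 ?finset.set11 ?finset.sub1set //.
- by rewrite finset.subUset !finset.sub1set n1N.
- by rewrite cards2; case: (_ != _).
- exact: finset.set21.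
Qed.

End Spread.

(** * Executions *)

(** Messages carry an arbitrary type without decidable equality, hence a recursive proposition
    rather than list membership. *)
Definition every (X : Type) (P : X -> Prop) (s : seq X) : Prop :=
  foldr (fun x Q => P x /\ Q) True s.

Lemma every_cat (X : Type) (P : X -> Prop) (s t : seq X) :
  every P (s ++ t) <-> every P s /\ every P t.
Proof. by elim: s => [|x s IH] /=; [tauto|rewrite IH; tauto]. Qed.

(** * Safety: correct nodes deliver nothing but [m0] *)

Section Safety.
Variables (T : finType) (M : Type) (e : rel T) (B : {set T}) (src : T) (m0 : M) (Z : nat).
Hypothesis e_sym : symmetric e.
Hypothesis Z_gt2 : 2 < Z.
Hypothesis byz_far : forall b b' p, b \in B -> b' \in B -> path e b p -> last b p = b' ->
  size p <= Z -> b = b'.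
Hypothesis srcB : src \notin B.
Implicit Types (v p q : T) (m : M) (A : {set T}) (c : config T M).

(* A wrong message forwarded by correct nodes carries the identifier of the Byzantine
   node that forged it, which is at most as far as the size of the set. *)
Definition genuine v m A : Prop := m = m0 \/ exists b s,
  [/\ b \in B, b \in A, path e v s, last v s = b & size s <= #|A|].

Definition sound_msg v (x : message T M) : Prop :=
  match x with Info m => m = m0 | Relay m A => genuine v m A end.

Definition sound_channel v w (x : message T M) : Prop :=
  e v w /\ (v \notin B -> sound_msg v x).

Definition sound_state v (st : local_state T M) : Prop :=
  (forall m, delivered st = Some m -> m = m0) /\
  (forall p m A, Rec st p = Some (m, A) ->
     [/\ e p v, p \notin A, #|A| <= Z - 3 & p \notin B -> genuine p m A]).

Lemma genuine0 v m : genuine v m finset.set0 -> m = m0.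
Proof. by case=> // -[b [s [_]]]; rewrite finset.in_set0. Qed.

(** If [q] is Byzantine, then [p] is not, being two hops away. A forger in [A] would be within
    [Z - 3] hops of [p], hence within [Z - 1] of [q], so it would be [q] itself, which is not in
    [A]. *)
Lemma deliver_genuine v (rec : T -> option (M * {set T})) m :
  (forall p m' A, rec p = Some (m', A) ->
     [/\ e p v, p \notin A, #|A| <= Z - 3 & p \notin B -> genuine p m' A]) ->
  can_deliver rec m -> m = m0.
Proof.
move=> recP [p [q [A [qp qA /recP[eqv _ _ gq] /recP[epv _ cA gp]]]]].
have [qB|/gq/genuine0//] := boolP (q \in B).
have evp : e v p by rewrite e_sym.
have [pB|/gp[//|[b [s [bB bA ps sb ss]]]]] := boolP (p \in B).
  have := byz_far qB pB (p := [:: v; p]); rewrite /= eqv evp => /(_ isT erefl (ltnW Z_gt2)) E.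
  by rewrite E eqxx in qp.
have qb : q = b.
  apply: (byz_far qB bB (p := v :: p :: s)) => //; first by rewrite /= eqv evp.
  by rewrite /=; move: (leq_trans ss cA) Z_gt2; clear; lia.
by move: qA; rewrite qb bA.
Qed.

Lemma reaction_sound v input (st st' : local_state T M) (out : seq (message T M)) :
  v \notin B ->
  (forall q x, input = Some (q, x) -> sound_channel q v x) ->
  sound_state v st -> reaction e src m0 Z v input st st' out ->
  sound_state v st' /\ every (sound_msg v) out.
Proof.
move=> vB inP [dP rP]; rewrite /reaction.
have keep : st' = st /\ out = [::] -> sound_state v st' /\ every (sound_msg v) out.
  by case=> -> ->.
case: ifP => [_|_].
  rewrite /source_reaction; case: (delivered st) => [_|]; first exact: keep.
  by case=> -> ->; split=> //; split=> //= m [].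
case: ifP => [_|_].
  rewrite /neighbor_reaction; case: (delivered st) => [_|]; first exact: keep.
  case: input inP => [[q [m|m A]]|] inP; try exact: keep.
  case: eqP => [qs|_]; last exact: keep.
  have [_] := inP _ _ erefl; rewrite qs => /(_ srcB) /= -> [-> ->].
  by split; [split=> //= m' []|split=> //; left].
rewrite /other_reaction; case: (delivered st) => [_|]; first exact: keep.
case: input inP => [[q [m|m A]]|] inP; try exact: keep.
case: ifP => [/andP[qA cA]|_]; last exact: keep.
have [eqv gq] := inP _ _ erefl; set rec' := [eta _ with _ |-> _].
have rec'P p m' A' : rec' p = Some (m', A') ->
    [/\ e p v, p \notin A', #|A'| <= Z - 3 & p \notin B -> genuine p m' A'].
  by rewrite /rec' /=; case: eqP => [-> [<- <-]|_ /rP].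
(* A Byzantine [q] is itself the forger, one hop away. Otherwise the walk to the forger and the set
   both grow by one, as [q] is not in [A]. *)
have fwd : genuine v m (q |: A)%SET.
  have evq : e v q by rewrite e_sym.
  have [qB|/gq[->|[b [s [bB bA ps sb ss]]]]] := boolP (q \in B); last 2 first.
  - by left.
  - right; exists b, (q :: s); split=> //; first by rewrite finset.in_setU bA orbT.
      by rewrite /= evq.
    by rewrite cardsU1 qA /= add1n ltnS.
  right; exists q, [:: q]; split=> //; first by rewrite finset.setU11.
    by rewrite /= evq.
  by rewrite cardsU1 qA.
case=> [[m' [cd -> ->]]|[ncd -> ->]]; last by split.
have m'0 := deliver_genuine rec'P cd.
by split; [split=> // m'' [<-]|split=> //; split=> //; left].
Qed.

Definition sound c : Prop :=
  (forall p q, every (sound_channel p q) (channel c p q)) /\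
  (forall v, v \notin B -> sound_state v (state c v)).

Lemma step_sound c a c' : step e B src m0 Z c a c' -> sound c -> sound c'.
Proof.
case: a => v oq [ch [input [out [recv same chE re]]]] [cP sP]; rewrite /= in same chE re.
have [chP inP] : (forall p q, every (sound_channel p q) (ch p q)) /\
    (forall q x, input = Some (q, x) -> sound_channel q v x).
  case: oq recv => [q [x [r [qx -> ->]]]|[-> ->]] //.
  have := cP q v; rewrite qx => -[xP rP]; split=> [p w|_ _ [<- <-]] //.
  by case: ifP => // /andP[/eqP-> /eqP->].
split=> [p q|w wB]; last first.
  have [wv|wv] := eqVneq w v; last by rewrite same //; exact: sP.
  rewrite wv in wB *; have [l rl _] := re wB.
  by have [] := reaction_sound wB inP (sP _ wB) rl.
rewrite chE; apply/every_cat; split=> //; case: ifP => // /andP[/eqP-> evq].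
have [vB|vB] := boolP (v \in B).
  by elim: (out q) => //= x s IH; split=> //; split=> //; rewrite vB.
have [l rl ->] := re vB; have [_] := reaction_sound vB inP (sP _ vB) rl.
by elim: l {rl} => //= x s IH [xP sP']; split; [split|exact: IH].
Qed.

End Safety.

(** * Liveness: fair channels and relayed copies *)

Section Liveness.
Variables (T : finType) (M : Type) (e : rel T) (B : {set T}) (src : T) (m0 : M) (Z : nat).
Hypotheses (e_sym : symmetric e) (e_irr : irreflexive e).
Hypothesis Z_gt2 : 2 < Z.
Hypothesis byz_far : forall b b' p, b \in B -> b' \in B -> path e b p -> last b p = b' ->
  size p <= Z -> b = b'.
Hypothesis srcB : src \notin B.
Variables (cfg : nat -> config T M) (act : nat -> activation T).
Hypothesis exec : execution e B src m0 Z cfg act.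
Implicit Types (v w p q : T) (m : M) (A : {set T}) (n k t : nat).

Notation chan n := (channel (cfg n)).
Notation dlv n v := (delivered (state (cfg n) v)).

Lemma cfg_sound n : sound e B m0 Z (cfg n).
Proof.
case: exec => -[st0 ch0] st _ _; elim: n => [|n IH].
  by split=> [p q|v vB]; rewrite ?ch0 // st0; split.
exact: step_sound (st n) IH.
Qed.

Lemma delivered_m0 n v m : v \notin B -> dlv n v = Some m -> m = m0.
Proof. by move=> vB; have [_ /(_ v vB)[dP _]] := cfg_sound n; exact: dP. Qed.

Lemma reaction_done v input (st st' : local_state T M) (out : seq (message T M)) m :
  reaction e src m0 Z v input st st' out -> delivered st = Some m ->
  st' = st /\ out = [::].
Proof.
move=> + dm; rewrite /reaction; case: ifP => _; first by rewrite /source_reaction dm.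
by case: ifP => _; rewrite /neighbor_reaction /other_reaction dm.
Qed.

Lemma delivered_step n v m : v \notin B -> dlv n v = Some m -> dlv n.+1 v = Some m.
Proof.
move=> vB dm; case: exec => _ st _ _.
have [ch [input [out [_ same _ re]]]] := st n.
have [vn|vn] := eqVneq v (act n).1; last by rewrite same.
move: re; rewrite -vn => /(_ vB)[l rl _].
by have [-> _] := reaction_done rl dm.
Qed.

Lemma delivered_mono n k v m : v \notin B -> n <= k -> dlv n v = Some m -> dlv k v = Some m.
Proof.
move=> vB /subnKC<-; elim: (k - n) => [|j IH] dm; first by rewrite addn0.
by rewrite addnS; apply: delivered_step => //; exact: IH.
Qed.

Lemma channel_step n p q : exists s, [/\
  chan n.+1 p q = (if act n == (q, Some p) then behead (chan n p q) else chan n p q) ++ s,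
  act n = (q, Some p) -> chan n p q <> [::] &
  p \notin B -> dlv n p <> None -> s = [::]].
Proof.
case: exec => _ st _ _; have [ch [input [out [recv _ chE re]]]] := st n.
exists (if (p == (act n).1) && e (act n).1 q then out q else [::]); split.
- rewrite chE; congr (_ ++ _); case: (act n) recv => v [p'|] /=.
    case=> [x [r [qx -> _]]].
    have -> : ((v, Some p') == (q, Some p)) = (p == p') && (q == v).
      by apply/eqP/andP => [[-> ->]|[/eqP-> /eqP->]].
    by have [->|_] := eqVneq p p'; have [->|_] := eqVneq q v; rewrite //= qx.
  by case=> ->; rewrite xpair_eqE andbF.
- by case: (act n) recv => v [p'|] // [x [r [qx _ _]]] [<- <-]; rewrite qx.
- move=> pB dp; case: eqP => //= pn; case: ifP => // _.
  move: re; rewrite -pn => /(_ pB)[l rl ->].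
  by case dE: (dlv n p) dp => [m|] // _; have [] := reaction_done rl dE.
Qed.

Lemma delivered_silent n k p : p \notin B -> n <= k -> dlv n p <> None -> dlv k p <> None.
Proof.
by move=> pB nk; case dE: (dlv n p) => [m|] // _; rewrite (delivered_mono pB nk dE).
Qed.

(** Fairness yields a later reception on this channel, and the first one takes the head. A correct
    sender that has delivered adds nothing behind it. *)
Lemma receive_head n p q x r : chan n p q = x :: r ->
  exists k s, [/\ n <= k, act k = (q, Some p), chan k p q = x :: r ++ s &
    p \notin B -> dlv n p <> None -> s = [::]].
Proof.
move=> nx; case: exec => _ _ _ /(_ p q n); rewrite nx => /(_ _)[|k0 nk0 ak0] //.
move: ak0; rewrite -(subnKC nk0); move: (k0 - n) => j aj {nk0}.
elim: j n x r nx aj => [|j IH] n x r nx.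
  by rewrite addn0 => an; exists n, [::]; rewrite cats0.
move=> aj; have [an|an] := eqVneq (act n) (q, Some p).
  by exists n, [::]; rewrite cats0.
have [s [chE _ sE]] := channel_step n p q.
rewrite (negPf an) nx in chE.
have [|k [s' [nk ak chk s'E]]] := IH n.+1 _ _ chE; first by rewrite addSnnS.
exists k, (s ++ s'); split=> //; first exact: ltnW.
  by rewrite chk catA.
move=> pB dp; rewrite sE ?s'E //; exact: delivered_silent pB (leqnSn n) dp.
Qed.

Lemma receive_later n p q x s r : chan n p q = s ++ x :: r ->
  exists k r', [/\ n <= k, act k = (q, Some p), chan k p q = x :: r' &
    p \notin B -> dlv n p <> None -> r' = r].
Proof.
elim: s n r => [|y s IH] n r nx.
  have [k [s [nk ak chk sE]]] := receive_head nx.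
  by exists k, (r ++ s); split=> // pB dp; rewrite sE ?cats0.
have [k [s' [nk ak chk s'E]]] := receive_head nx.
have [s2 [chk1 _ s2E]] := channel_step k p q.
have [|k' [r' [kk' ak' chk' r'E]]] := IH k.+1 (r ++ s' ++ s2).
  by rewrite chk1 ak eqxx chk /= -!catA.
exists k', r'; split=> //; first exact: leq_trans nk (ltnW kk').
move=> pB dp; have dk := delivered_silent pB nk dp.
rewrite r'E ?s'E ?s2E ?cats0 //; exact: delivered_silent pB (leqnSn k) dk.
Qed.

Lemma step_correct n v : v \notin B -> (act n).1 = v -> exists input l,
  [/\ reaction e src m0 Z v input (state (cfg n) v) (state (cfg n.+1) v) l,
      match (act n).2 with
      | None => input = None
      | Some q => exists x r, chan n q v = x :: r /\ input = Some (q, x)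
      end &
      forall w, e v w -> exists s, chan n.+1 v w = s ++ l].
Proof.
move=> vB an; case: exec => _ st _ _; have [ch [input [out [recv _ chE re]]]] := st n.
move: re chE; rewrite an => /(_ vB)[l rl outE] chE; exists input, l; split=> //.
  case: (act n) recv an => v' [q|] /=; last by case.
  by case=> [x [r [qx _ ->]]] <-; exists x, r.
by move=> w evw; exists (ch v w); rewrite chE eqxx evw outE.
Qed.

Definition stuck v : Prop := v \notin B /\ forall n, dlv n v = None.

(** [n] is the last instant before delivery, so that the activation of index [n] is the delivering
    one. *)
Lemma not_stuck v : v \notin B -> ~ stuck v -> exists n,
  dlv n v = None /\ forall k, n < k -> dlv k v = Some m0.
Proof.
move=> vB ns; have [n dn] : exists n, dlv n v <> None.
  by apply: contrapT => none; apply: ns; split=> // n; apply: contrapT => dn; apply: none; exists n.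
elim: n dn => [|n IH]; first by case: exec => -[st0 _] _ _ _; rewrite st0.
case dE: (dlv n v) => [m|]; first by move=> _; apply: IH; rewrite dE.
case dE': (dlv n.+1 v) => [m|] // _; exists n; split=> // k nk.
by rewrite (delivered_mono vB nk dE') (delivered_m0 vB dE').
Qed.

Lemma stuck_src : ~ stuck src.
Proof.
case=> _ dn; case: exec => _ _ /(_ src 0)[k _ ak] _.
have [input [l [rl _ _]]] := step_correct srcB ak.
move: rl; rewrite /reaction eqxx /source_reaction dn => -[E _].
by have := dn k.+1; rewrite E.
Qed.

Lemma not_stuck_delivers v : v \notin B -> ~ stuck v -> eventually_delivers cfg v m0.
Proof. by move=> vB /(not_stuck vB)[n [_ dn]]; exists n.+1 => k; exact: dn. Qed.

Lemma stuck_src_adj v : stuck v -> v <> src /\ e src v = false.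
Proof.
move=> sv; have vs : v <> src by move=> vs; apply: stuck_src; rewrite -vs.
split=> //; apply/negP => esv; have [vB dn] := sv.
have [n [dsn dsS]] := not_stuck srcB stuck_src.
have an : (act n).1 = src.
  apply/eqP/negPn/negP => an; case: exec => _ /(_ n)[ch [input [out [_ same _ _]]]] _ _.
  by have := dsS n.+1 (ltnSn n); rewrite same ?dsn // eq_sym.
have [input [l [rl _ lE]]] := step_correct srcB an.
move: rl; rewrite /reaction eqxx /source_reaction dsn => -[_ lI].
have [s] := lE v esv; rewrite lI => /receive_later[k [r [_ ak chk _]]].
have [|input' [l' [rl' inE _]]] := @step_correct k v vB; first by rewrite ak.
move: inE; rewrite ak /= chk => -[x [r' [[<- _] input'E]]].
move: rl'; rewrite /reaction; case: eqP => // _; rewrite esv /neighbor_reaction dn input'E eqxx.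
by case=> E _; have := dn k.+1; rewrite E.
Qed.

Definition gets v p A t : Prop :=
  act t = (v, Some p) /\ exists r, chan t p v = Relay m0 A :: r.

(** A stuck node never meets the delivery condition, so it keeps storing and forwarding every
    acceptable pair. *)
Lemma stuck_relay v p A t : stuck v -> gets v p A t -> p \notin A -> #|A| <= Z - 3 ->
  [/\ Rec (state (cfg t.+1) v) p = Some (m0, A),
      forall m, ~ can_deliver (Rec (state (cfg t.+1) v)) m &
      forall w, e v w -> exists2 t', t < t' & gets w v (p |: A)%SET t'].
Proof.
move=> sv [at_ [r cht]] pA cA; have [vB dn] := sv; have [vs sv'] := stuck_src_adj sv.
have [|input [l [rl inE lE]]] := @step_correct t v vB; first by rewrite at_.
move: inE; rewrite at_ /= cht => -[x [r' [[<- _] inputE]]].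
move: rl; rewrite /reaction; case: eqP => // _; rewrite sv' /other_reaction dn inputE pA cA /=.
case=> [[m' [_ E _]]|[ncd E lE']]; first by have := dn t.+1; rewrite E.
rewrite E /= eqxx; split=> // w evw; have [s] := lE w evw.
rewrite lE' => /receive_later[k [r'' [tk ak chk _]]].
by exists k => //; split=> //; exists r''.
Qed.

(* The last message that a node ever sends is its delivery; channels are queues, so
   it is also the last one that is received. *)
Lemma gets_final v q : stuck v -> q \notin B -> ~ stuck q -> e q v ->
  exists2 t, gets v q finset.set0 t &
    forall k, t < k -> Rec (state (cfg k) v) q = Some (m0, finset.set0).
Proof.
move=> sv qB nsq eqv; have [n [dqn dqS]] := not_stuck qB nsq.
have [vB dn] := sv; have [vs sv'] := stuck_src_adj sv.
have qs : q != src by apply: contraFneq sv' => <-.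
have an : (act n).1 = q.
  apply/eqP/negPn/negP => an; case: exec => _ /(_ n)[ch [input [out [_ same _ _]]]] _ _.
  by have := dqS n.+1 (ltnSn n); rewrite same ?dqn // eq_sym.
have [input [l [rl _ lE]]] := step_correct qB an.
(* Whichever reaction delivers, its last message is the direct pair, preceded at most by a forwarded
   copy. *)
have [l' l'E] : exists l', l = rcons l' (Relay m0 finset.set0).
  move: rl (dqS n.+1 (ltnSn n)); rewrite /reaction (negPf qs); case: ifP => _.
    rewrite /neighbor_reaction dqn; case: input => [[p [m|m A]]|]; try by case=> ->; rewrite dqn.
    by case: eqP => _ [-> ->] /=; [case=> ->; exists [::]|rewrite dqn].
  rewrite /other_reaction dqn; case: input => [[p [m|m A]]|]; try by case=> ->; rewrite dqn.
  case: ifP => _; last by case=> ->; rewrite dqn.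
  case=> [[m' [_ -> ->]] /= [->]|[_ -> _] //].
  by exists [:: Relay m (p |: A)%SET].
have [s chn] := lE v eqv; rewrite l'E -cats1 catA in chn.
have [t [r [nt at_ cht rE]]] := receive_later chn.
have dq1 : dlv n.+1 q <> None by rewrite dqS.
have {rE} rE : r = [::] by exact: rE.
have gt : gets v q finset.set0 t by split=> //; exists [::]; rewrite cht rE.
exists t => //; have s0 : #|@finset.set0 T| <= Z - 3 by rewrite cards0.
have [recT _ _] := stuck_relay sv gt (negbT (finset.in_set0 q)) s0.
(* From then on the channel from [q] stays empty, so every later update of [Rec] concerns another
   neighbor. *)
suff later j : Rec (state (cfg (t.+1 + j)) v) q = Some (m0, finset.set0) /\
    chan (t.+1 + j) q v = [::].
  by move=> k tk; have [+ _] := later (k - t.+1); rewrite subnKC.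
elim: j => [|j [recj chj]].
  rewrite addn0; split=> //; have [s' [-> _ s'E]] := channel_step t q v.
  by rewrite at_ eqxx cht rE s'E //; exact: delivered_silent qB nt dq1.
rewrite addnS; set k := t.+1 + j in recj chj *.
have dk : dlv k q <> None.
  by apply: delivered_silent qB _ dq1; apply: leq_trans nt _; rewrite /k addSn; exact: leqW (leq_addr _ _).
split; last first.
  have [s' [-> _ s'E]] := channel_step k q v; rewrite s'E // cats0 chj.
  by case: ifP.
have [av|av] := eqVneq (act k).1 v; last first.
  case: exec => _ /(_ k)[ch [input' [out [_ same _ _]]]] _ _.
  by rewrite same // eq_sym.
have [input' [l2 [rl' inE _]]] := step_correct vB av.
move: rl'; rewrite /reaction; case: eqP => // _; rewrite sv' /other_reaction dn.
case: input' inE => [[p [m|m A]]|] inE; try by case=> ->.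
case: ifP => _; last by case=> ->.
have pq : q != p.
  apply/eqP => qp; move: inE; case: (act k).2 => [p'|//] [x [r' [chp [p'p _]]]].
  by move: chp; rewrite -p'p -qp chj.
by case=> [[m' [_ -> _]]|[_ -> _]] /=; rewrite (negPf pq).
Qed.

(** Each hop adds only the previous sender to the set. Simplicity of the path passes the membership
    tests, and the size bound passes the tests against [Z - 3]. *)
Lemma relay_chain v ws q A t : gets v q A t -> stuck v -> (forall w, w \in ws -> stuck w) ->
  path e v ws -> uniq (v :: ws) -> q \notin v :: ws -> q \notin A ->
  (forall w, w \in v :: ws -> w \notin A) -> #|A| + size ws <= Z - 3 ->
  exists t' p A', [/\ t <= t', gets (last v ws) p A' t', p \notin A', #|A'| <= Z - 3 &
    p = last q (belast v ws) /\ forall u, u \in A' -> u \in A \/ u \in q :: belast v ws].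
Proof.
elim: ws v q A t => [|w ws IH] v q A t gv sv sws /=.
  move=> _ _ _ qA _; rewrite addn0 => cA; exists t, q, A; split=> //; split=> // u; by left.
move=> /andP[evw pw] /andP[vN uw] qN qA wA sz.
have cA : #|A| <= Z - 3 by exact: leq_trans (leq_addr _ _) sz.
have [_ _ /(_ w evw)[t1 tt1 gw]] := stuck_relay sv gv qA cA.
have [||||||||t2 [p [A' [t12 gl pA' cA' [pE A'P]]]]] := IH w v (q |: A)%SET t1 gw.
- by apply: sws; exact: mem_head.
- by move=> u uws; apply: sws; rewrite inE uws orbT.
- by [].
- by [].
- by [].
- rewrite finset.in_setU1 negb_or wA ?mem_head // andbT; apply: contraNneq qN => ->.
  exact: mem_head.
- move=> u uws; rewrite finset.in_setU1 negb_or wA ?andbT; last by rewrite inE uws orbT.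
  by apply: contraNneq qN => <-; rewrite inE uws orbT.
- by rewrite cardsU1 qA add1n addSnnS.
exists t2, p, A'; split=> //; first exact: leq_trans (ltnW tt1) t12.
split=> // u /A'P[|]; last by move=> uvw; right; rewrite inE uvw orbT.
by rewrite finset.in_setU1 => /orP[/eqP->|]; [right; exact: mem_head|left].
Qed.

(* Copies of the messages of [q] and [u] cross along the path; at one of its ends the
   relayed copy arrives after the direct one, which is never overwritten. *)
Lemma no_stuck_path q w ws u : path e q (rcons (w :: ws) u) -> uniq (q :: rcons (w :: ws) u) ->
  size (w :: ws) <= Z - 2 -> q \notin B -> ~ stuck q -> u \notin B -> ~ stuck u ->
  (forall v, v \in w :: ws -> stuck v) -> False.
Proof.
(* The pair of [x] reaches the last node, relayed, at some [t] not before [a]. If the direct pair of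
   [z] were already there, that node would deliver; hence [a < b]. *)
have half a b x y l z : path e x (rcons (y :: l) z) -> uniq (x :: rcons (y :: l) z) ->
    size (y :: l) <= Z - 2 -> (forall v, v \in y :: l -> stuck v) ->
    gets y x finset.set0 a -> gets (last y l) z finset.set0 b ->
    (forall k, b < k -> Rec (state (cfg k) (last y l)) z = Some (m0, finset.set0)) -> a < b.
  move=> pl ul sl stl ga gb bE.
  move: (ul); rewrite /= => /and3P[xN yN ul'].
  have yl : uniq (y :: l).
    by move: ul' yN; rewrite rcons_uniq mem_rcons inE negb_or /= => /andP[_ ->] /andP[_ ->].
  have xl : x \notin y :: l.
    by apply: contra xN; rewrite !inE mem_rcons inE => /orP[->|->]; rewrite ?orbT.
  have pyl : path e y l by move: pl; rewrite /= rcons_path => /and3P[].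
  have [||||||||t [p [A [at_ gt pA cA [pE AP]]]]] := @relay_chain y l x finset.set0 a ga.
  - by apply: stl; exact: mem_head.
  - by move=> v vl; apply: stl; rewrite inE vl orbT.
  - by [].
  - by [].
  - by [].
  - by rewrite finset.in_set0.
  - by move=> v _; rewrite finset.in_set0.
  (* The bound [Z - 2] counts [y], which [relay_chain] leaves out. *)
  - by rewrite cards0 add0n; move: sl; rewrite /=; move: (size l); clear; lia.
  apply: leq_ltn_trans at_ _.
  have zN : z \notin x :: belast y l.
    move: ul; rewrite -rcons_cons rcons_uniq => /andP[zN _].
    apply: contra zN; rewrite !inE => /orP[->//|/mem_belast].
    by rewrite inE => ->; rewrite orbT.
  have zp : z != p.
    by apply: contraNneq zN => ->; rewrite pE -[_ :: _]/(belast x (y :: l)) mem_last.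
  have [tb|bt|tb] := ltngtP t b => //; last first.
    by move: gt.1 gb.1; rewrite tb => -> [pz]; rewrite pz eqxx in zp.
  have sl' : stuck (last y l) by apply: stl; exact: mem_last.
  have [recp ncd _] := stuck_relay sl' gt pA cA.
  case: (ncd m0); exists p, z, A; split=> //.
    by apply/negP => /AP[]; rewrite ?finset.in_set0 ?(negPf zN).
  by apply: bE; exact: ltnW.
move=> pl ul sl qB nq uB nu st.
have sw : stuck w by apply: st; exact: mem_head.
have sl' : stuck (last w ws) by apply: st; exact: mem_last.
have eqw : e q w by case/andP: pl.
have elu : e u (last w ws) by rewrite e_sym; move: pl; rewrite /= rcons_path => /and3P[].
have [a ga aE] := gets_final sw qB nq eqw.
have [b gb bE] := gets_final sl' uB nu elu.
have ab := half _ _ _ _ _ _ pl ul sl st ga gb bE.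
have rE : rev (w :: ws) = last w ws :: rev (belast w ws) by rewrite lastI rev_rcons.
(* The same argument on the reversed path gives the opposite inequality. *)
suff : b < a by rewrite ltnNge (ltnW ab).
apply: (half b a u (last w ws) (rev (belast w ws)) q).
- rewrite -rE; apply: path_steps => x y; rewrite steps_rev_rcons mem_rev.
  by move=> /mapP[[x' y'] xy [-> ->]]; rewrite e_sym; exact: steps_path pl xy.
- by rewrite -rE -rcons_cons -rev_rcons -rev_cons rev_uniq.
- by rewrite -rE size_rev.
- by move=> v; rewrite -rE mem_rev; exact: st.
- exact: gb.
- by rewrite -(last_cons w) -rE rev_cons last_rcons.
- by rewrite -(last_cons w) -rE rev_cons last_rcons.
Qed.

End Liveness.

Unset Implicit Arguments.

(* [Z] is the maximal number of edges of a polygon, for either meaning of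
   "polygon": with or without edges drawn inside.  The minimum distance [D] is
   infinite when there is at most one Byzantine node. *)
Theorem theorem1 (R : realType) (T : finType) (e : rel T)
    (e_sym : symmetric e) (e_irr : irreflexive e)
    (emb : plane_embedding R e) (e_4conn : four_connected e)
    (Z : nat)
    (Z_max : max_edges (polygon emb) Z \/ max_edges (elementary_polygon emb) Z)
    (B : {set T})
    (D_gt_Z : forall b b' : T, b \in B -> b' \in B -> b != b' -> (Z < dist e b b')%N)
    (src : T) (src_correct : src \notin B)
    (M : Type) (m0 : M)
    (cfg : nat -> config T M) (act : nat -> activation T)
    (exec : execution e B src m0 Z cfg act) :
  forall v : T, v \notin B -> eventually_delivers cfg v m0.
Proof.
(* Elementary polygons are polygons, so both readings of [Z_max] bound them. *)
have Z_face c : elementary_polygon emb c -> (size c <= Z)%N.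
  by case: Z_max => [[_ le] [pc _]|[_ le] pc]; exact: le.
have Z_gt2 : (2 < Z)%N.
  by case: Z_max => [[[c [[_ c2] _] <-] _]|[[c [[[_ c2] _] _] <-] _]].
have byz_far := walk_byz D_gt_Z.
have stuckP := not_stuck_delivers e_sym Z_gt2 byz_far src_correct exec.
move=> v vB; apply: stuckP => // sv.
pose W := [set w | (w \notin B) && `[< ~ stuck B cfg w >]]%SET.
have WE w : (w \in W) = (w \notin B) && `[< ~ stuck B cfg w >] by rewrite finset.in_set.
have WB w : w \notin (W :|: B)%SET -> stuck B cfg w.
  rewrite finset.in_setU negb_or WE => /andP[+ wB]; rewrite wB /= => /asboolPn.
  exact: contrapT.
(* [v] plays the part of [u0]. Nodes outside [W] and [B] are exactly the stuck ones, so
   [no_stuck_path] supplies the condition on linking paths. *)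
apply: (@spread_contradiction R T e e_sym e_irr emb e_4conn Z Z_gt2 Z_face B W src v) => //.
- rewrite WE src_correct; apply/asboolP.
  exact: (stuck_src src_correct exec).
- move=> y sy; apply: contraT => /WB.
  case/(stuck_src_adj e_sym Z_gt2 byz_far src_correct exec) => _.
  by rewrite sy.
- move=> q [|w ws] u // _ sz pq uq; rewrite !WE => /andP[qB /asboolP nq] /andP[uB /asboolP nu] sub.
  apply: (no_stuck_path e_sym Z_gt2 byz_far src_correct exec pq uq sz qB nq uB nu) => y /sub.
  by rewrite finset.in_setC; exact: WB.
- by rewrite finset.in_setU negb_or vB andbT WE; apply/nandP; right; apply/asboolPn.
Qed.
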